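(* For each $j\ge1$ let $\mathcal H_j$ be a complex Hilbert space with a distinguished unit vector $w_j\in\mathcal H_j$, let $(\Sigma_j,\mathcal M_j)$ be a measurable space with a distinguished point $t_j\in\Sigma_j$, let $\mu_j$ be a $\sigma$-finite measure on $(\Sigma_j,\mathcal M_j)$, and let $\pi_j:\Sigma_j\to\mathbb B(\mathcal H_j)$ be an everywhere defined map with $\pi_j(t_j)=1_{\mathcal H_j}$ and $\pi_j\in\mathrm{SQ}(\mathbb B(\mathcal H_j),\mu_j)$. Let $\mathbf w=\{w_j\}_{j\ge1}$, let $\mathcal H=\widehat{\bigotimes}^{\mathbf w}_{j\ge1}\mathcal H_j$, let $\Sigma$ be the restricted Cartesian product of $\{\Sigma_j\}_{j\ge1}$ along $\{t_j\}_{j\ge1}$, and let $\pi:\Sigma\to\mathbb B(\mathcal H)$ be the restricted tensor product of $\{\pi_j\}_{j\ge1}$ along $\{t_j\}_{j\ge1}$ and $\mathbf w$. For every $N\ge1$ define $$\theta^{(N)}:\Sigma_1\times\cdots\times\Sigma_N\to\Sigma,\qquad\theta^{(N)}(s_1,\dots,s_N)=(s_1,\dots,s_N,t_{N+1},t_{N+2},\dots)$$ and consider the measure $\mu^{(N)}:=(\theta^{(N)})_*(\mu_1\otimes\cdots\otimes\mu_N)$ on $\Sigma$. Then $\pi$ is weakly measurable and square integrable with respect to the sequence of measures $\{\mu^{(N)}\}_{N\ge1}$, that is, $$\lim_{N\to\infty}\int_\Sigma\langle\pi(s)u_1,v_1\rangle\langle v_2,\pi(s)u_2\rangle\,d\mu^{(N)}(s)=\langle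 u_1,u_2\rangle\langle v_2,v_1\rangle\quad\text{for all }u_1,u_2,v_1,v_2\in\mathcal H.$$
   Context: Inner products are linear in the first variable and antilinear in the second. A map $\pi:\Sigma\to\mathbb B(\mathcal H)$ is weakly measurable if $s\mapsto\langle\pi(s)u,v\rangle$ is measurable for all $u,v\in\mathcal H$. $\mathrm{SQ}(\mathbb B(\mathcal H),\mu)$ denotes the set of all weakly measurable maps $\pi:\Sigma\to\mathbb B(\mathcal H)$ such that $\int_\Sigma\langle\pi(s)u_1,v_1\rangle\langle v_2,\pi(s)u_2\rangle\,d\mu(s)=\langle u_1,u_2\rangle\langle v_2,v_1\rangle$ for all $u_1,u_2,v_1,v_2\in\mathcal H$. $\mathcal H=\widehat{\bigotimes}^{\mathbf w}_{j\ge1}\mathcal H_j$ is the (completed) Hilbert space inductive limit of $\mathcal H^{(N)}:=\mathcal H_1\widehat\otimes\cdots\widehat\otimes\mathcal H_N$ with respect to the isometric embeddings $\mathcal H^{(N)}\to\mathcal H^{(N+1)}$, $x\mapsto x\otimes w_{N+1}$. The restricted Cartesian product is $\Sigma:=\{s=\{s_j\}_{j\ge1}\in\prod_{j\ge1}\Sigma_j\mid\exists j(s)\ge1\ \forall j\ge j(s):\ s_j=t_j\}$, endowed with the restricted product of the $\sigma$-algebras $\mathcal M_j$, i.e. the $\sigma$-algebra on $\Sigma$ induced by the product $\sigma$-algebra of $\prod_{j\ge1}\Sigma_j$. The restricted tensor product is $\pi(\{s_j\}_{j\ge1}):=\bigotimes_{j\ge1}\pi_j(s_j)\in\mathbb B(\mathcal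 H)$; since $\pi_j(s_j)=1_{\mathcal H_j}$ for all $j>N$ with $N$ large depending on $s$, this is the operator $\pi_1(s_1)\otimes\cdots\otimes\pi_N(s_N)\otimes1$ under the identification $\mathcal H\cong\mathcal H^{(N)}\widehat\otimes\bigl(\widehat{\bigotimes}^{\{w_j\}_{j>N}}_{j>N}\mathcal H_j\bigr)$. *)

(* Defs.v *)
From HB Require Import structures.
From mathcomp Require Import all_boot all_order all_algebra.
From mathcomp Require Import sesquilinear complex.
From mathcomp Require Import all_classical all_reals all_analysis.

Set Implicit Arguments.
Unset Strict Implicit.
Unset Printing Implicit Defensive.

Import Order.TTheory GRing.Theory Num.Theory.
Import numFieldNormedType.Exports.

Local Open Scope classical_set_scope.
Local Open Scope ring_scope.

(* Sequences are indexed from 0: the index j stands for j + 1 in H_1, H_2, ... *)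

(* A dot product is linear in its first argument and, through Num.conj,
   antilinear in the second. *)
HB.mixin Record CompleteNormedModule_isHilbert (R : realType) V
    & CompleteNormedModule R[i] V := {
  inner : {dot V for (@Num.conj R[i])} ;
  inner_normE : forall x : V, inner x x = `|x| ^+ 2
}.

#[short(type="hilbertType")]
HB.structure Definition Hilbert (R : realType) :=
  {V of CompleteNormedModule R[i] V & CompleteNormedModule_isHilbert R V}.

#[short(type="bounded_op")]
HB.structure Definition BoundedOp (R : realType) (H : hilbertType R) :=
  {f of @GRing.Linear R[i] H H *:%R f & @Continuous H H f}.

Section bounded_operators.
Context (R : realType) (H : hilbertType R).

HB.instance Definition _ := gen_eqMixin (bounded_op H).
HB.instance Definition _ := gen_choiceMixin (bounded_op H).

Let idfun_continuous : continuous (idfun : H -> H).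
Proof. by move=> x. Qed.

HB.instance Definition _ := isContinuous.Build H H idfun idfun_continuous.
HB.instance Definition _ := isPointed.Build (bounded_op H) (idfun : bounded_op H).

End bounded_operators.

(* The Hilbert space tensor product, i.e. the completion of the algebraic one
   for the inner product determined by [ht_inner]; it is unique up to a unique
   unitary operator compatible with the tensors. *)
Record hilbert_tensor (R : realType) (A B : hilbertType R) := HilbertTensor {
  ht_space :> hilbertType R ;
  ht_mul : {bilinear A -> B -> ht_space} ;
  ht_inner : forall (a a' : A) (b b' : B),
    inner (ht_mul a b) (ht_mul a' b') = inner a a' * inner b b' ;
  ht_dense : closure [set x : ht_space | exists n (a : 'I_n -> A) (b : 'I_n -> B),
    x = \sum_(i < n) ht_mul (a i) (b i)] = setT
}.

(* The Hilbert space inductive limit of a sequence of isometric embeddings. *)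
Record hilbert_indlim (R : realType) (V : nat -> hilbertType R)
    (e : forall n, V n -> V n.+1) := HilbertIndlim {
  hl_space :> hilbertType R ;
  hl_map : forall n, {linear V n -> hl_space} ;
  hl_isometry : forall n (x : V n), `|hl_map n x| = `|x| ;
  hl_compat : forall n (x : V n), hl_map n.+1 (e n x) = hl_map n x ;
  hl_dense : closure (\bigcup_n range (hl_map n)) = setT
}.

Section tensor_products.
Context (R : realType) (tens : forall A B : hilbertType R, hilbert_tensor A B).
Variable H : nat -> hilbertType R.

Fixpoint tensor_upto (n : nat) : hilbertType R :=
  if n is m.+1 then tens (tensor_upto m) (H m.+1) : hilbertType R else H 0%N.

Definition tensor_embed (w : forall j, H j) (n : nat) (x : tensor_upto n) :
    tensor_upto n.+1 :=
  ht_mul (tens (tensor_upto n) (H n.+1)) x (w n.+1).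

Fixpoint tensor_vect (n : nat) (x : forall j, H j) : tensor_upto n :=
  match n with
  | 0 => x 0%N
  | m.+1 => ht_mul (tens (tensor_upto m) (H m.+1)) (tensor_vect m x) (x m.+1)
  end.

Definition restricted_tensor (w : forall j, H j) : Type :=
  hilbert_indlim (tensor_embed w).

End tensor_products.

Section restricted_product.
Context (d : nat -> measure_display) (S : forall j, measurableType (d j)).

Record rprod (t : forall j, S j) := RProd {
  rprod_val :> forall j, S j ;
  rprodP : exists J, forall j, (J <= j)%N -> rprod_val j = t j
}.

Definition product_sigma_algebra : set (set (forall j, S j)) :=
  <<s \bigcup_j preimage_set_system setT (fun s => s j) measurable >>.

Variable t : forall j, S j.

HB.instance Definition _ := gen_eqMixin (rprod t).
HB.instance Definition _ := gen_choiceMixin (rprod t).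
HB.instance Definition _ := isPointed.Build (rprod t)
  (RProd (ex_intro _ 0%N (fun j _ => erefl (t j)))).

Let rprod_sigma : set (set (rprod t)) :=
  preimage_set_system setT (@rprod_val t) product_sigma_algebra.

Let rprod_sigma_algebra : sigma_algebra setT rprod_sigma.
Proof.
by apply: sigma_algebra_preimage; exact: smallest_sigma_algebra.
Qed.

Let rprod_sigma0 : rprod_sigma set0.
Proof. by case: rprod_sigma_algebra. Qed.

Let rprod_sigmaC A : rprod_sigma A -> rprod_sigma (~` A).
Proof. by case: rprod_sigma_algebra => _ + _ => /[apply]; rewrite setTD. Qed.

Let rprod_sigmaU (F : (set (rprod t))^nat) :
  (forall i, rprod_sigma (F i)) -> rprod_sigma (\bigcup_i F i).
Proof. by case: rprod_sigma_algebra => _ _; exact. Qed.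

HB.instance Definition _ := isMeasurable.Build (preimage_display (@rprod_val t))
  (rprod t) rprod_sigma0 rprod_sigmaC rprod_sigmaU.

Lemma measurable_rprod_coord j :
  measurable_fun setT (fun s : rprod t => rprod_val s j).
Proof.
move=> _ A mA; rewrite setTI.
exists ((fun s : forall j, S j => s j) @^-1` A); last by rewrite setTI.
by apply: sub_gen_smallest; exists j => //; exists A => //; rewrite setTI.
Qed.

Lemma measurable_to_rprod d' (T : measurableType d') (f : T -> rprod t) :
  (forall j, measurable_fun setT (fun x => rprod_val (f x) j)) ->
  measurable_fun setT f.
Proof.
move=> mf _ _ [B mB <-]; rewrite !setTI.
pose G : set (set (forall j, S j)) :=
  [set B | measurable ((fun x => rprod_val (f x)) @^-1` B)].
suff : product_sigma_algebra `<=` G by exact.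
apply: smallest_sub.
  split; rewrite /G/=.
  - by rewrite preimage_set0.
  - by move=> A; rewrite setTD preimage_setC => /measurableC.
  - by move=> F mF; rewrite preimage_bigcup; exact: bigcup_measurable.
move=> _ [j _ [A mA <-]]; rewrite /G/= setTI -comp_preimage.
by rewrite -[X in measurable X]setTI; exact: mf.
Qed.

(* the left-associated product of the first n + 1 factors *)
Fixpoint fprod_display (n : nat) : measure_display :=
  if n is m.+1 then measure_prod_display (fprod_display m, d n) else d 0%N.

Fixpoint fprod (n : nat) : measurableType (fprod_display n) :=
  match n return measurableType (fprod_display n) with
  | 0 => S 0%N
  | m.+1 => (fprod m * S m.+1)%type
  end.

Fixpoint fprod_fill (n : nat) : fprod n -> forall j, S j :=
  match n return fprod n -> forall j, S j with
  | 0 => fun x => dfwith t 0%N x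
  | m.+1 => fun p => dfwith (fprod_fill p.1) m.+1 p.2
  end.

Lemma fprod_fill_out n (p : fprod n) j : (n < j)%N -> fprod_fill p j = t j.
Proof.
elim: n p => [|n IHn] p nj /=; first by rewrite dfwithout// ltn_eqF.
by rewrite dfwithout ?ltn_eqF// IHn// ltnW.
Qed.

Definition theta (n : nat) (p : fprod n) : rprod t :=
  RProd (ex_intro _ n.+1 (fun j => @fprod_fill_out n p j)).

Lemma measurable_theta n : measurable_fun setT (@theta n).
Proof.
apply: measurable_to_rprod => j /=.
elim: n => [|n IHn] /=.
  have [->|j0] := eqVneq j 0%N.
    by under eq_fun do rewrite dfwithin; exact: measurable_id.
  by under eq_fun do rewrite dfwithout 1?eq_sym//; exact: measurable_cst.
have [->|jn] := eqVneq j n.+1.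
  by under eq_fun do rewrite dfwithin; exact: measurable_snd.
under eq_fun do rewrite dfwithout 1?eq_sym//.
exact: (measurableT_comp IHn measurable_fst).
Qed.

End restricted_product.

Section product_measures.
Context (R : realType) (d : nat -> measure_display)
  (S : forall j, measurableType (d j))
  (mu : forall j, {sigma_finite_measure set (S j) -> \bar R}).

Fixpoint fprod_measure (n : nat) : {measure set (fprod S n) -> \bar R} :=
  match n return {measure set (fprod S n) -> \bar R} with
  | 0 => mu 0%N
  | m.+1 => (fprod_measure m \x mu m.+1)%E
  end.

Variable t : forall j, S j.

Definition mu_upto (n : nat) : set (rprod t) -> \bar R :=
  pushforward (fprod_measure n) (@theta _ _ t n).

Let mu_upto_measure (n : nat) : {measure set (rprod t) -> \bar R} :=
  measure_function_pushforward__canonical__measure_function_Measure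
    (fprod_measure n) (@measurable_theta _ _ t n).

HB.instance Definition _ n := Measure.copy (mu_upto n) (mu_upto_measure n).

End product_measures.

Arguments mu_upto {R d S} mu t n _.

Section complex_integral.
Context d (T : measurableType d) (R : realType).

Definition cmeasurable (f : T -> R[i]) : Prop :=
  measurable_fun setT (fun x => complex.Re (f x)) /\
  measurable_fun setT (fun x => complex.Im (f x)).

Definition cintegrable (mu : {measure set T -> \bar R}) (f : T -> R[i]) : Prop :=
  mu.-integrable setT (fun x => (complex.Re (f x))%:E) /\
  mu.-integrable setT (fun x => (complex.Im (f x))%:E).

Definition cintegral (mu : {measure set T -> \bar R}) (f : T -> R[i]) : R[i] :=
  Complex (\int[mu]_x complex.Re (f x))%R (\int[mu]_x complex.Im (f x))%R.

End complex_integral.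

Section square_integrable.
Context d (T : measurableType d) (R : realType) (H : hilbertType R).
Implicit Types (mu : {measure set T -> \bar R}) (pi : T -> bounded_op H).

Definition weakly_measurable pi : Prop :=
  forall u v : H, cmeasurable (fun s => inner (pi s u) v).

Definition SQ_integrand pi (u1 v1 u2 v2 : H) (s : T) : R[i] :=
  inner (pi s u1) v1 * inner v2 (pi s u2).

Definition SQ mu : set (T -> bounded_op H) :=
  [set pi | weakly_measurable pi /\ forall u1 v1 u2 v2 : H,
    cintegrable mu (SQ_integrand pi u1 v1 u2 v2) /\
    cintegral mu (SQ_integrand pi u1 v1 u2 v2) = inner u1 u2 * inner v2 v1].

Definition square_integrable_seq (mu : nat -> {measure set T -> \bar R}) pi :
    Prop :=
  forall u1 v1 u2 v2 : H,
    (forall n, cintegrable (mu n) (SQ_integrand pi u1 v1 u2 v2)) /\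
    cintegral (mu n) (SQ_integrand pi u1 v1 u2 v2) @[n --> \oo]
      --> inner u1 u2 * inner v2 v1.

End square_integrable.

Section restricted_tensor_operator.
Context (R : realType) (tens : forall A B : hilbertType R, hilbert_tensor A B).
Context (H : nat -> hilbertType R) (w : forall j, H j).
Context (L : restricted_tensor tens w).
Context (d : nat -> measure_display) (S : forall j, measurableType (d j)).
Context (t : forall j, S j) (pi : forall j, S j -> bounded_op (H j)).

(* pi_1(s_1) (x) ... (x) pi_N(s_N) (x) 1, where s_j = t_j for j > N, is the
   bounded operator with
     x_1 (x) ... (x) x_M (x) w_{M+1} (x) w_{M+2} (x) ... |->
     pi_1(s_1) x_1 (x) ... (x) pi_M(s_M) x_M (x) w_{M+1} (x) w_{M+2} (x) ...
   for all M >= N; recall that pi_j(t_j) = 1.  These vectors span a dense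
   subspace, so there is at most one such operator, and [get] picks it. *)
Definition restricted_tensor_op (s : rprod t) : bounded_op L :=
  get [set P : bounded_op L | forall M : nat,
    (forall j, (M < j)%N -> rprod_val s j = t j) ->
    forall x : (forall j, H j),
      P (hl_map L M (tensor_vect tens M x)) =
      hl_map L M (tensor_vect tens M (fun j => pi (rprod_val s j) (x j)))].

End restricted_tensor_operator.

Arguments restricted_tensor_op {R tens H w} L {d S} t pi s.

(* Main.v *)
Require Import Defs.
From HB Require Import structures.
From mathcomp Require Import all_boot all_order all_algebra.
From mathcomp Require Import sesquilinear complex.
From mathcomp Require Import all_classical all_reals all_analysis.
From mathcomp Require Import measurable_realfun.
From mathcomp Require Import ring.

Set Implicit Arguments.
Unset Strict Implicit.
Unset Printing Implicit Defensive.

Import Order.TTheory GRing.Theory Num.Theory.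
Import numFieldNormedType.Exports.

Local Open Scope classical_set_scope.
Local Open Scope ring_scope.

(* For an element p of the first n factors, write T_n(p) for the tensor product
   of the operators pi_j(p_j), j <= n.  By Fubini on elementary tensors and
   density, T_n is in SQ for the product measure.  On H^(M) with M >= n the
   operator pi(theta_n p) acts as T_n(p) (x) 1.  Expanding two vectors of
   H^(M) over a common orthonormal family of last factors and combining
   Minkowski's inequality with Cauchy-Schwarz shows that tensoring by an
   identity preserves the bound ||<A(.)u, v>||_{L^2} <= |u| |v|, which holds for
   T_n because it is in SQ.  By Fatou's lemma the bound extends to all u, v in H:
   for every n the functions s |-> <pi(s)u, v> have mu^(n)-norm at most |u| |v|.
   For vectors coming from H^(M) the integral equals its limit as soon as n >= M,
   and the bound, being uniform in n, carries the convergence over to H. *)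

(* [R[i]] carries its topology only through the generic one of [numFieldType]. *)
Local Notation CC R := (R[i] : numFieldType).
Local Notation rn x := (complex.Re `|x|).

(** * Sequences, inner products and bounded operators *)

(** The obstacle is that [pi] is in general not in SQ for any single measure [mu_upto mu t n]. The
    factors beyond [n] are integrated as identities, and an identity contributes [<x1,y1><y2,x2>]
    where SQ asks for [<x1,x2><y2,y1>]. For [x1 = x2] and [y1 = y2] the former is at most the
    latter, which is why an inequality survives and why the result is a limit. No bound on the
    operators [pi(s)] uniform in [s] is available, so approximating vectors gives only pointwise
    convergence of the functions [<pi(s)u, v>]; hence Fatou rather than domination. The spaces are
    known only through characterizing properties, and operators on them through [get]. Each operator
    therefore has to be constructed first, as the closure of a bounded linear relation with dense
    domain. *)

Lemma cvg_dist_squeeze (K : numFieldType) (V : normedModType K)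
    (x_ : nat -> V) (x : V) (r_ : nat -> K) :
  (forall n, `|x - x_ n| <= r_ n) -> r_ n @[n --> \oo] --> (0 : K) ->
  x_ @ \oo --> x.
Proof.
move=> xr r0; apply/cvgrPdist_le => e e0.
near=> n; apply: (le_trans (xr n)).
rewrite -[r_ n]ger0_norm; last exact: le_trans (xr n).
by near: n; exact: cvgr0_norm_le.
Unshelve. all: by end_near. Qed.

Lemma cvg_invn_complex (R : realType) :
  (n.+1%:R^-1 : CC R) @[n --> \oo] --> (0 : CC R).
Proof.
apply/cvgr0Pnorm_le => -[a b]; rewrite ltcE /= => /andP[/eqP -> a0].
near=> n; rewrite ger0_norm ?invr_ge0//.
have -> : (n.+1%:R^-1 : R[i]) = (n.+1%:R^-1 : R)%:C%C.
  by rewrite fmorphV rmorph_nat.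
rewrite complexr0 lecR ltW//.
by near: n; exact: near_infty_natSinv_lt (PosNum a0).
Unshelve. all: by end_near. Qed.

Lemma closure_seq (R : realType) (V : normedModType (CC R)) (D : set V) (x : V) :
  closure D x ->
  exists x_ : nat -> V, (forall n, D (x_ n)) /\ x_ @ \oo --> x.
Proof.
move=> Dx; have /(_ _)/cid P n : exists y, D y /\ `|x - y| < n.+1%:R^-1.
  have [|y [Dy xy]] := Dx (ball x n.+1%:R^-1).
    by apply: nbhsx_ballx; rewrite invr_gt0 ltr0n.
  by exists y; split=> //; move: xy; rewrite -ball_normE.
exists (fun n => sval (P n)); split=> [n|]; first by case: (svalP (P n)).
apply: (@cvg_dist_squeeze _ _ _ _ (fun n => n.+1%:R^-1) _
  (@cvg_invn_complex R)) => n.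
by case: (svalP (P n)) => _ /ltW.
Qed.

Section inner_product.
Context (R : realType) (H : hilbertType R).
Implicit Types (u v x y : H) (c : R[i]).

Lemma innerC u v : inner u v = (inner v u)^*.
Proof. by rewrite hermC /= expr0 mul1r. Qed.

Lemma innerDl u v x : inner (u + v) x = inner u x + inner v x.
Proof. exact: linearDl. Qed.

Lemma innerDr u v x : inner x (u + v) = inner x u + inner x v.
Proof. exact: linearDr. Qed.

Lemma innerBl u v x : inner (u - v) x = inner u x - inner v x.
Proof. exact: linearBl. Qed.

Lemma innerBr u v x : inner x (u - v) = inner x u - inner x v.
Proof. exact: linearBr. Qed.

Lemma innerZl c u v : inner (c *: u) v = c * inner u v.
Proof. exact: linearZl_LR. Qed.

Lemma innerZr c u v : inner u (c *: v) = c^* * inner u v.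
Proof. exact: linearZr_LR. Qed.

Lemma inner0r u : inner u 0 = 0.
Proof. exact: linear0r. Qed.

Lemma inner_suml I r (P : pred I) (F : I -> H) u :
  inner (\sum_(i <- r | P i) F i) u = \sum_(i <- r | P i) inner (F i) u.
Proof. exact: linear_sumlz. Qed.

Lemma inner_sumr I r (P : pred I) (F : I -> H) u :
  inner u (\sum_(i <- r | P i) F i) = \sum_(i <- r | P i) inner u (F i).
Proof. exact: linear_sumr. Qed.

Lemma cauchy_schwarz u v : `|inner u v| <= `|u| * `|v|.
Proof.
have [->|v0] := eqVneq v 0; first by rewrite inner0r !normr0 mulr0.
have nv : 0 < `|v| ^+ 2 by rewrite exprn_gt0// normr_gt0.
rewrite -(@ler_pXn2r _ 2)// ?nnegrE ?mulr_ge0// exprMn.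
(* [c *: v] is the projection of [u] on [v]; the remainder has squared norm
   [|u|^2 - |<u,v>|^2 / |v|^2]. *)
pose c := inner u v / `|v| ^+ 2.
have e : inner (u - c *: v) v = 0.
  by rewrite innerBl innerZl inner_normE divfK ?subrr// gt_eqF.
have := exprn_ge0 2 (normr_ge0 (u - c *: v)).
rewrite -inner_normE innerBr innerZr e mulr0 subr0 innerBl innerZl.
rewrite (innerC v u) inner_normE subr_ge0 /c mulrAC -normCK.
by rewrite ler_pdivrMr.
Qed.

Lemma cvg_inner (u_ v_ : nat -> H) u v : u_ @ \oo --> u -> v_ @ \oo --> v ->
  inner (u_ n) (v_ n) @[n --> \oo] --> inner u v.
Proof.
move=> uu vv.
apply: (@cvg_dist_squeeze _ _ _ _ (fun n => `|u - u_ n| * `|v| +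
  `|u_ n| * `|v - v_ n|)).
  move=> n; have -> : inner u v - inner (u_ n) (v_ n) =
      inner (u - u_ n) v + inner (u_ n) (v - v_ n).
    by rewrite innerBl innerBr addrA subrK.
  by apply: (le_trans (ler_normD _ _)); rewrite lerD// cauchy_schwarz.
rewrite -[0](_ : `|u - u| * `|v| + `|u| * `|v - v| = 0); last first.
  by rewrite !subrr !normr0 mul0r mulr0 addr0.
apply: cvgD.
- by apply: cvgM; [apply: cvg_norm; apply: cvgB => //; exact: cvg_cst|
    exact: cvg_cst].
- by apply: cvgM; apply: cvg_norm => //; apply: cvgB => //; exact: cvg_cst.
Qed.

End inner_product.

Section limits.
Context (K : numFieldType) (V W : normedModType K).

(** The order of a [numFieldType] is only partial. Nonnegativity of [r_ n - |x_ n|] is therefore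
    read as an equation, namely that it equals its own norm, and equations pass to limits. *)
Lemma norm_limit_le (x_ : nat -> V) (r_ : nat -> K) (x : V) (r : K) :
  x_ @ \oo --> x -> r_ @ \oo --> r -> (forall n, `|x_ n| <= r_ n) -> `|x| <= r.
Proof.
move=> xx rr xr; have d : r_ n - `|x_ n| @[n --> \oo] --> (r - `|x| : K).
  exact: (cvgB rr (cvg_norm xx)).
have dn : r_ n - `|x_ n| @[n --> \oo] --> (`|r - `|x| | : K).
  under [X in X @ _]eq_fun do rewrite -[_ - _]ger0_norm ?subr_ge0//.
  exact: cvg_norm d.
rewrite -subr_ge0 ger0_def; apply/eqP.
exact: (cvg_unique (@norm_hausdorff (K) (K)) dn d).
Qed.

Lemma linear_bound_continuous (f : {linear V -> W})
  (c : K) : (forall x, `|f x| <= c * `|x|) -> continuous f.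
Proof.
move=> fc; apply: bounded_linear_continuous; apply/linear_boundedP.
have c0 : 0 <= `|c| by [].
exists `|c|; split; first exact: ger0_real.
move=> r cr x /=; apply: (le_trans (fc x)).
have [->|x0] := eqVneq x 0; first by rewrite normr0 !mulr0.
(* [c] is not assumed real, but a nonzero [x] with [0 <= c * |x|] forces it to be nonnegative. *)
rewrite ler_wpM2r//; apply: le_trans (ltW cr); rewrite real_ler_norm//.
have : 0 <= c * `|x| by apply: le_trans (fc x).
by rewrite pmulr_lge0 ?normr_gt0// => /ger0_real.
Qed.

Lemma continuous_linear_bound (f : {linear V -> W}) :
  continuous f -> exists2 c : K, 0 <= c & forall x, `|f x| <= c * `|x|.
Proof.
move=> cf; have /linear_boundedP[c [cr cP]] : bounded_near f (nbhs (0 : V)).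
  exact: continuous_linear_bounded (cf 0).
exists (`|c| + 1); first by rewrite addr_ge0.
by move=> x; apply: cP; rewrite (le_lt_trans (real_ler_norm cr))// ltrDl.
Qed.

End limits.

Section bounded_extension.
Context (R : realType) (H : hilbertType R).

Lemma bounded_op_of (f : H -> H) (c : R[i]) : linear f ->
  (forall x, `|f x| <= c * `|x|) -> exists P : bounded_op H, P =1 f.
Proof.
move=> lf fc.
pose fl : {linear H -> H} := HB.pack f (GRing.isLinear.Build _ _ _ _ f lf).
have fcont : continuous fl := linear_bound_continuous (f := fl) fc.
pose P : bounded_op H := HB.pack f (GRing.isLinear.Build _ _ _ _ f lf)
  (isContinuous.Build _ _ f fcont).
by exists P.
Qed.

Lemma bounded_op_bound (A : bounded_op H) :
  exists2 c : R[i], 0 <= c & forall x, `|A x| <= c * `|x|.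
Proof. by apply: continuous_linear_bound; exact: cts_fun. Qed.

Lemma cvg_bounded_op (A : bounded_op H) (x_ : nat -> H) (x : H) :
  x_ @ \oo --> x -> A (x_ n) @[n --> \oo] --> A x.
Proof. by move=> xx; apply: (cvg_comp x_ A xx); exact: cts_fun. Qed.

(** [G] is the graph of a densely defined operator. A relation is convenient because one vector has
    many expressions as a sum of tensors, or comes from several levels of an inductive limit;
    linearity and the bound make the value unique. *)
Lemma bounded_extension (G : H -> H -> Prop) (c : R[i]) : 0 <= c ->
  (forall a x y x' y', G x y -> G x' y' -> G (a *: x + x') (a *: y + y')) ->
  (forall x y, G x y -> `|y| <= c * `|x|) ->
  closure [set x | exists y, G x y] = setT ->
  exists P : bounded_op H, (forall x, `|P x| <= c * `|x|) /\
    forall x y, G x y -> P x = y.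
Proof.
move=> c_ge0 Glin Gc Gd.
(* The closure of the graph, described by sequences. *)
pose Q (x y : H) := exists p : nat -> H * H,
  [/\ forall n, G (p n).1 (p n).2, (fun n => (p n).1) @ \oo --> x &
      (fun n => (p n).2) @ \oo --> y].
have Qc x y : Q x y -> `|y| <= c * `|x|.
  move=> [p [Gp px py]].
  apply: (@norm_limit_le _ _ (fun n => (p n).2) (fun n => c * `|(p n).1|)) => //.
    by apply: cvgM; [exact: cvg_cst|exact: cvg_norm].
  by move=> n; exact: Gc.
have Qlin a x y x' y' : Q x y -> Q x' y' -> Q (a *: x + x') (a *: y + y').
  move=> [p [Gp px py]] [p' [Gp' px' py']].
  exists (fun n => (a *: (p n).1 + (p' n).1, a *: (p n).2 + (p' n).2)).
  split=> [n||] /=; first exact: Glin.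
  - by apply: cvgD => //; apply: cvgZ => //; exact: cvg_cst.
  - by apply: cvgD => //; apply: cvgZ => //; exact: cvg_cst.
have Quniq x y y' : Q x y -> Q x y' -> y = y'.
  move=> Qxy Qxy'; apply/eqP; rewrite -subr_eq0 -normr_le0.
  have := Qc _ _ (Qlin (-1) _ _ _ _ Qxy' Qxy).
  by rewrite !scaleN1r addNr normr0 mulr0 addrC.
have Qtot x : exists y, Q x y.
  have [x_ [/(_ _)/cid xG xx]] : exists x_ : nat -> H,
      (forall n, exists y, G (x_ n) y) /\ x_ @ \oo --> x.
    by apply: (@closure_seq _ _ [set x | exists y, G x y]); rewrite Gd.
  pose y_ n := sval (xG n).
  have yG n : G (x_ n) (y_ n) by exact: svalP.
  suff /cvg_ex[y yy] : cvg (y_ @ \oo) by exists y, (fun n => (x_ n, y_ n)).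
  apply: cauchy_cvg; apply/cauchy_exP => e e0.
  (* [c] may be zero, hence the division by [c + 1]. *)
  have c0 : 0 < c + 1 by rewrite ltr_wpDl.
  have xe : \forall n \near \oo, `|x - x_ n| < e / 2 / (c + 1).
    by apply: cvgr_dist_lt => //; rewrite !divr_gt0.
  case: (xe) => N _ NP; exists (y_ N), N => // n /= Nn.
  rewrite -ball_normE /=.
  have -> : y_ N - y_ n = (-1) *: y_ n + y_ N by rewrite scaleN1r addrC.
  apply: (le_lt_trans (Gc _ _ (Glin (-1) _ _ _ _ (yG n) (yG N)))).
  have -> : -1 *: x_ n + x_ N = (x - x_ n) - (x - x_ N).
    by rewrite scaleN1r opprB (addrC (x_ N)) addrACA subrr add0r.
  apply: (@le_lt_trans _ _ ((c + 1) * `|x - x_ n - (x - x_ N)|)).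
    by rewrite ler_wpM2r// lerDl.
  rewrite -ltr_pdivlMl// mulrC.
  apply: (le_lt_trans (ler_normB _ _)).
  by rewrite [e]splitr mulrDl ltrD//; apply: NP => /=.
have /choice[f fQ] := Qtot.
have [|P PE] := @bounded_op_of f c _ (fun x => Qc _ _ (fQ x)).
  by move=> a x y; apply: (Quniq (a *: x + y)) => //; exact: Qlin.
exists P; split=> [x|x y Gxy]; first by rewrite PE; exact: Qc.
rewrite PE; apply: (Quniq x) => //.
by exists (fun=> (x, y)); split=> //=; exact: cvg_cst.
Qed.

End bounded_extension.

(** * Tensor products of operators *)

Section orthonormal.
Context (R : realType) (H : hilbertType R).
Implicit Types (x y : H) (e : nat -> H).

Definition orthonormal_upto (n : nat) e :=
  forall k l, (k < n)%N -> (l < n)%N -> inner (e k) (e l) = (k == l)%:R.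

(** The normalized residual of [y] is appended unless it vanishes, so dependent lists are allowed.
    With [e] indexed by [nat] the family grows without changing type. *)
Lemma gram_schmidt (s : seq H) : exists n e, orthonormal_upto n e /\
  forall x, x \in s -> x = \sum_(k < n) inner x (e k) *: e k.
Proof.
elim: s => [|y s [n [e [oe es]]]]; first by exists 0%N, (fun=> 0); split.
pose r := y - \sum_(k < n) inner y (e k) *: e k.
have [r0|r0] := eqVneq r 0.
  exists n, e; split=> // x; rewrite inE => /predU1P[->|]; last exact: es.
  by apply/eqP; rewrite -subr_eq0 -/r r0.
pose f := `|r|^-1 *: r.
have nr0 : `|r| != 0 by rewrite normr_eq0.
have re l : (l < n)%N -> inner r (e l) = 0.
  move=> ln; rewrite innerBl inner_suml (bigD1 (Ordinal ln)) //= innerZl.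
  rewrite oe// eqxx mulr1 big1 ?addr0 ?subrr// => k kl.
  by rewrite innerZl oe// (negbTE (kl : val k != l)) mulr0.
have fe l : (l < n)%N -> inner f (e l) = 0.
  by move=> ln; rewrite innerZl re// mulr0.
have ef l : (l < n)%N -> inner (e l) f = 0.
  by move=> ln; rewrite innerC fe// rmorph0.
have ff : inner f f = 1.
  rewrite innerZl innerZr inner_normE conj_Creal ?rpredV ?normr_real//.
  by rewrite expr2 mulKf// mulVf.
exists n.+1, (fun k => if k == n then f else e k); split.
  move=> k l; rewrite !ltnS [(k <= n)%N]leq_eqVlt [(l <= n)%N]leq_eqVlt.
  move=> /predU1P[->|kn] /predU1P[->|ln].
  - by rewrite !eqxx.
  - by rewrite eqxx (ltn_eqF ln) fe// eq_sym (ltn_eqF ln).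
  - by rewrite eqxx (ltn_eqF kn) ef.
  - by rewrite (ltn_eqF kn) (ltn_eqF ln) oe.
move=> x xs; rewrite big_ord_recr /= eqxx.
under eq_bigr do rewrite ltn_eqF//.
move: xs; rewrite inE => /predU1P[->|xs].
  have -> : inner y f = `|r|.
    have {1}-> : y = r + \sum_(k < n) inner y (e k) *: e k by rewrite subrK.
    rewrite innerDl inner_suml big1 ?addr0; last first.
      by move=> k _; rewrite innerZl ef ?mulr0.
    by rewrite innerZr inner_normE conj_Creal ?rpredV ?normr_real// expr2 mulKf.
  by rewrite scalerA mulfV// scale1r /r addrC subrK.
have -> : inner x f = 0.
  rewrite (es _ xs) inner_suml big1// => k _.
  by rewrite innerZl ef ?mulr0.
by rewrite scale0r addr0; exact: es.
Qed.

End orthonormal.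

Section algebraic_tensor.
Context (R : realType) (A B : hilbertType R) (X : hilbert_tensor A B).

(** With lists of pairs, addition is concatenation and no index types have to be merged. *)
Definition tensor_sum (s : seq (A * B)) : X := \sum_(p <- s) ht_mul X p.1 p.2.

Lemma tensor_sum_dense : closure (range tensor_sum) = setT.
Proof.
rewrite -(ht_dense X); congr closure; apply/seteqP; split => x /=.
  move=> [s _ <-]; exists (size s), (fun i => (tnth (in_tuple s) i).1),
    (fun i => (tnth (in_tuple s) i).2).
  by rewrite /tensor_sum [LHS]big_tnth.
move=> [n [a [b ->]]]; exists [seq (a i, b i) | i <- index_enum 'I_n] => //.
by rewrite /tensor_sum big_map.
Qed.

Lemma ht_norm a b : `|ht_mul X a b| = `|a| * `|b|.
Proof.
apply/eqP; rewrite -(@eqrXn2 _ 2)// ?mulr_ge0//.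
by rewrite exprMn -!inner_normE ht_inner.
Qed.

Lemma ht_inner_orthonormal n (e : nat -> B) (u v : nat -> A) :
  orthonormal_upto n e ->
  inner (\sum_(k < n) ht_mul X (u k) (e k)) (\sum_(k < n) ht_mul X (v k) (e k)) =
  \sum_(k < n) inner (u k) (v k).
Proof.
move=> oe; rewrite inner_suml; apply: eq_bigr => k _.
rewrite inner_sumr (bigD1 k)//= ht_inner oe// eqxx mulr1 big1 ?addr0// => l lk.
by rewrite ht_inner oe// [(k : nat) == l]eq_sym (negbTE (lk : val l != k)) mulr0.
Qed.

Lemma tensor_sum_orthonormal n (e : nat -> B) (s : seq (A * B)) :
  (forall p, p \in s -> p.2 = \sum_(k < n) inner p.2 (e k) *: e k) ->
  tensor_sum s =
  \sum_(k < n) ht_mul X (\sum_(p <- s) inner p.2 (e k) *: p.1) (e k).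
Proof.
move=> se; under eq_bigr do rewrite linear_sumlz.
rewrite exchange_big /= /tensor_sum big_seq [RHS]big_seq.
apply: eq_bigr => p ps; rewrite {1}(se p ps) linear_sumr.
by apply: eq_bigr => k _; rewrite linearZr_LR linearZl_LR.
Qed.

Lemma tensor_sum_cat s s' : tensor_sum (s ++ s') = tensor_sum s + tensor_sum s'.
Proof. by rewrite /tensor_sum big_cat. Qed.

Lemma tensor_sumZ c s :
  tensor_sum [seq (c *: p.1, p.2) | p <- s] = c *: tensor_sum s.
Proof.
rewrite /tensor_sum big_map scaler_sumr; apply: eq_bigr => p _.
by rewrite linearZl_LR.
Qed.

(* Over an orthonormal family of second factors the norm of a sum of tensors
   decouples, so [T (x) 1] inherits every bound of [T]; this also makes it
   well defined on sums. *)
Lemma tensor_left_exists (T : bounded_op A) : exists P : bounded_op X,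
  (forall c : R[i], 0 <= c -> (forall a, `|T a| <= c * `|a|) ->
    forall x, `|P x| <= c * `|x|) /\
  forall a b, P (ht_mul X a b) = ht_mul X (T a) b.
Proof.
pose T1 (p : A * B) := (T p.1, p.2).
pose G (x y : X) := exists s, x = tensor_sum s /\ y = tensor_sum (map T1 s).
have Gc (c : R[i]) : 0 <= c -> (forall a, `|T a| <= c * `|a|) ->
    forall x y, G x y -> `|y| <= c * `|x|.
  move=> c0 Tc x y [s [-> ->]].
  (* [T1] leaves second factors unchanged, so one family [e] serves both [x] and [y]. *)
  have [n [e [oe es]]] := gram_schmidt (map snd s).
  have se p : p \in s -> p.2 = \sum_(k < n) inner p.2 (e k) *: e k.
    by move=> ps; apply: es; exact: map_f.
  rewrite (tensor_sum_orthonormal se) (@tensor_sum_orthonormal n e); last first.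
    by move=> _ /mapP[p ps ->]; exact: (se p ps).
  rewrite -(@ler_pXn2r _ 2)// ?nnegrE ?mulr_ge0// exprMn -!inner_normE.
  rewrite (ht_inner_orthonormal (fun k => \sum_(p <- s) inner p.2 (e k) *: p.1)
    (fun k => \sum_(p <- s) inner p.2 (e k) *: p.1) oe).
  rewrite (ht_inner_orthonormal
    (fun k => \sum_(p <- map T1 s) inner p.2 (e k) *: p.1)
    (fun k => \sum_(p <- map T1 s) inner p.2 (e k) *: p.1) oe).
  rewrite mulr_sumr; apply: ler_sum => k _.
  rewrite !inner_normE -exprMn ler_pXn2r// ?nnegrE ?mulr_ge0//.
  (* The coefficient of [y] at [e k] is the image under [T] of that of [x]. *)
  apply: le_trans (Tc _); rewrite big_map linear_sum.
  by rewrite le_eqVlt (eq_bigr (fun p => T (inner p.2 (e k) *: p.1))) ?eqxx// => p _;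
    rewrite linearZ.
have [c c0 Tc] := bounded_op_bound T.
have [|||P [Pc PG]] := @bounded_extension _ X G c c0.
- move=> a x y x' y' [s [-> ->]] [s' [-> ->]].
  exists ([seq (a *: p.1, p.2) | p <- s] ++ s').
  rewrite map_cat !tensor_sum_cat tensor_sumZ; split=> //.
  rewrite -tensor_sumZ -!map_comp; congr (tensor_sum _ + _).
  by apply: eq_map => p /=; rewrite /T1 /= linearZ.
- exact: Gc.
- rewrite -tensor_sum_dense; congr closure; apply/seteqP; split=> x /=.
    by move=> [y [s [-> _]]]; exists s.
  by move=> [s _ <-]; exists (tensor_sum (map T1 s)), s.
exists P; split.
  (* [P] was built from one bound [c] of [T]; any other bound [c'] holds on the domain of [G] and
     passes to [P] by density. *)
  move=> c' c'0 Tc' x.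
  have [|x_ [xG xx]] := @closure_seq _ _ (range tensor_sum) x.
    by rewrite tensor_sum_dense.
  apply: (@norm_limit_le _ _ (fun n => P (x_ n)) (fun n => c' * `|x_ n|)).
  - exact: cvg_bounded_op.
  - by apply: cvgM; [exact: cvg_cst|exact: cvg_norm].
  - move=> n; case: (xG n) => s _ <-; apply: (Gc _ c'0 Tc').
    by exists s; split=> //; apply: PG; exists s.
move=> a b; apply: PG; exists [:: (a, b)].
by rewrite /tensor_sum !big_seq1.
Qed.

End algebraic_tensor.

Section tensor_operator.
Context (R : realType) (A B : hilbertType R) (X : hilbert_tensor A B).

Lemma hilbert_tensor_ext (P Q : bounded_op X) :
  (forall a b, P (ht_mul X a b) = Q (ht_mul X a b)) -> P =1 Q.
Proof.
move=> PQ x; have [|x_ [xG xx]] := @closure_seq _ _ (range (@tensor_sum _ _ _ X)) x.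
  by rewrite tensor_sum_dense.
have e : (fun n => P (x_ n)) = (fun n => Q (x_ n)).
  apply/funext => n; case: (xG n) => s _ <-; rewrite !linear_sum.
  by apply: eq_bigr => p _; exact: PQ.
have := cvg_bounded_op (A := P) xx; rewrite e => Px.
exact: (cvg_unique (@norm_hausdorff _ X) Px (cvg_bounded_op (A := Q) xx)).
Qed.

(** Exchanging the factors on the same space [X] lets [tensor_left_exists] also produce
    [1 (x) T]. *)
Let flip_mul (b : B) (a : A) : X := ht_mul X a b.

Let flip_bilinear : bilinear_for *:%R *:%R flip_mul.
Proof.
by split=> [a' u v b|b u v a]; rewrite /flip_mul; [exact: linearPr|exact: linearPl].
Qed.

HB.instance Definition _ :=
  @bilinear_isBilinear.Build _ _ _ _ _ _ flip_mul flip_bilinear.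

Let flip_inner b b' a a' :
  inner (flip_mul b a) (flip_mul b' a') = inner b b' * inner a a'.
Proof. by rewrite /flip_mul ht_inner mulrC. Qed.

Let flip_dense : closure [set x : X | exists n (b : 'I_n -> B) (a : 'I_n -> A),
  x = \sum_(i < n) flip_mul (b i) (a i)] = setT.
Proof.
rewrite -(ht_dense X); congr closure; apply/seteqP; split=> x /= [n [a [b ->]]];
  by exists n, b, a.
Qed.

Definition hilbert_tensor_flip : hilbert_tensor B A :=
  HilbertTensor flip_inner flip_dense.

Definition tensor_op (S : bounded_op A) (T : bounded_op B) : bounded_op X :=
  get [set P : bounded_op X |
    forall a b, P (ht_mul X a b) = ht_mul X (S a) (T b)].

(** The operator that [get] has to find is the composite of [S (x) 1] and [1 (x) T]. *)
Lemma tensor_opE S T a b :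
  tensor_op S T (ht_mul X a b) = ht_mul X (S a) (T b).
Proof.
have [P [_ PE]] := tensor_left_exists X S.
have [Q [_ QE]] := tensor_left_exists hilbert_tensor_flip T.
have [p p0 Pp] := bounded_op_bound P.
have [q q0 Qq] := bounded_op_bound Q.
have [||PQ PQE] := @bounded_op_of _ X (P \o Q) (p * q).
- by move=> c x y; rewrite /= !linearP.
- by move=> x; apply: (le_trans (Pp _)); rewrite -mulrA ler_wpM2l//; exact: Qq.
suff : [set P : bounded_op X |
    forall a b, P (ht_mul X a b) = ht_mul X (S a) (T b)] (tensor_op S T) by exact.
apply: getPex; exists PQ => a' b'; rewrite PQE /=.
by rewrite -PE; congr (P _); exact: QE.
Qed.

(** The constant does not grow with the extra factor, so a bound survives any number of identity
    factors. *)
Lemma tensor_op_bound (S : bounded_op A) (T : bounded_op B) (c : R[i]) :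
  T =1 id -> 0 <= c ->
  (forall a, `|S a| <= c * `|a|) -> forall x, `|tensor_op S T x| <= c * `|x|.
Proof.
move=> T1 c0 Sc x; have [P [Pc PE]] := tensor_left_exists X S.
rewrite (@hilbert_tensor_ext _ P); first exact: Pc.
by move=> a b; rewrite tensor_opE PE T1.
Qed.

End tensor_operator.

Section restricted_operator.
Context (R : realType) (tens : forall A B : hilbertType R, hilbert_tensor A B).
Context (H : nat -> hilbertType R).
Local Notation HN := (tensor_upto tens H).

Lemma eq_tensor_vect n (x y : forall j, H j) :
  (forall j, (j <= n)%N -> x j = y j) ->
  tensor_vect tens n x = tensor_vect tens n y.
Proof.
elim: n => [|n IHn] xy /=; first exact: xy.
by rewrite xy// IHn// => j jn; apply: xy; exact: leqW.
Qed.

(** This is totality of elementary tensors in dual form. With the last factor [b] fixed, the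
    induction hypothesis applies to the partial map, which is bounded by [c * |b|]; density of
    finite sums does the rest. *)
Lemma tensor_upto_total n (V : hilbertType R) (f : HN n -> V) (c : R[i]) :
  linear f -> (forall x, `|f x| <= c * `|x|) ->
  (forall x, f (tensor_vect tens n x) = 0) -> forall y, f y = 0.
Proof.
elim: n f c => [|n IHn] f c lf fc f0 y.
  by have := f0 (@dfwith nat H (fun=> 0) 0%N y); rewrite /= dfwithin.
pose fl : {linear HN n.+1 -> V} := HB.pack f (GRing.isLinear.Build _ _ _ _ f lf).
have f0' a b : f (ht_mul (tens (HN n) (H n.+1)) a b) = 0.
  apply: (IHn (fun a => f (ht_mul (tens (HN n) (H n.+1)) a b)) (c * `|b|)).
  - by move=> k u v; rewrite linearPl lf.
  - by move=> u; apply: (le_trans (fc _)); rewrite ht_norm mulrAC mulrA.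
  - move=> x; have := f0 (@dfwith nat H x n.+1 b); rewrite /= dfwithin.
    rewrite (@eq_tensor_vect _ _ x) => [|j jn]; first exact.
    by rewrite dfwithout// gtn_eqF.
have [|y_ [yG yy]] := @closure_seq _ _
    (range (@tensor_sum _ _ _ (tens (HN n) (H n.+1)))) y.
  by rewrite tensor_sum_dense.
apply/eqP; rewrite -normr_le0.
have <- : c * `|y - y| = 0 by rewrite subrr normr0 mulr0.
apply: (@norm_limit_le _ _ (fun=> f y) (fun n => c * `|y - y_ n|)).
- exact: cvg_cst.
- apply: cvgM; first exact: cvg_cst.
  by apply: cvg_norm; apply: cvgB => //; exact: cvg_cst.
- move=> m; suff <- : f (y - y_ m) = f y by [].
  case: (yG m) => s _ <-; have fs : fl (tensor_sum _ s) = 0.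
    by rewrite linear_sum big1// => p _; exact: f0'.
  by apply: (etrans (linearB fl y (tensor_sum _ s))); rewrite fs subr0.
Qed.

Fixpoint tensor_op_upto (T : forall j, bounded_op (H j)) (n : nat) :
    bounded_op (HN n) :=
  match n return bounded_op (HN n) with
  | 0 => T 0%N
  | m.+1 => tensor_op (tens (HN m) (H m.+1)) (tensor_op_upto T m) (T m.+1)
  end.

Lemma tensor_op_upto_vect T n x : tensor_op_upto T n (tensor_vect tens n x) =
  tensor_vect tens n (fun j => T j (x j)).
Proof. by elim: n => //= n IHn; rewrite tensor_opE IHn. Qed.

Context (w : forall j, H j) (L : restricted_tensor tens w).
Implicit Types T : forall j, bounded_op (H j).

Lemma hl_map_embed m n (z : HN m) : (m <= n)%N ->
  exists z' : HN n, hl_map L n z' = hl_map L m z.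
Proof.
elim: n => [|n IHn].
  by rewrite leqn0 => /eqP m0; subst m; exists z.
rewrite leq_eqVlt => /predU1P[mn|]; first by subst m; exists z.
rewrite ltnS => /IHn[z' <-].
by exists (tensor_embed w z'); rewrite hl_compat.
Qed.

(** The lift tensors [z] with [w j] for [m < j <= n]. The identity factors of [T] fix these vectors,
    so lifting commutes with the operators. *)
Lemma hl_map_lift T m n (z : HN m) : (m <= n)%N ->
  (forall j, (m < j)%N -> T j =1 id) ->
  exists z' : HN n, hl_map L n z' = hl_map L m z /\
    hl_map L n (tensor_op_upto T n z') = hl_map L m (tensor_op_upto T m z).
Proof.
move=> + T1; elim: n => [|n IHn].
  by rewrite leqn0 => /eqP m0; subst m; exists z.
rewrite leq_eqVlt => /predU1P[mn|]; first by subst m; exists z.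
rewrite ltnS => mn; have [z' [<- <-]] := IHn mn.
exists (tensor_embed w z'); rewrite hl_compat; split=> //.
by rewrite /= tensor_opE T1// hl_compat.
Qed.

(** The bound found at level [m] is inherited by later levels, whose extra factors are identities.
    Extending to [L] requires one constant for all levels. *)
Lemma tensor_op_upto_bound T m : (forall j, (m < j)%N -> T j =1 id) ->
  exists2 c : R[i], 0 <= c & forall n, (m <= n)%N -> forall z,
    `|tensor_op_upto T n z| <= c * `|z|.
Proof.
move=> T1; have [c c0 Tc] := bounded_op_bound (tensor_op_upto T m).
exists c => //; elim=> [|n IHn].
  by rewrite leqn0 => /eqP m0; subst m.
rewrite leq_eqVlt => /predU1P[mn|]; first by subst m.
by rewrite ltnS => mn z; apply: tensor_op_bound => //; [exact: T1|exact: IHn].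
Qed.

Lemma restricted_op_exists T :
  (exists m, forall j, (m < j)%N -> T j =1 id) ->
  exists P : bounded_op L, forall n, (forall j, (n < j)%N -> T j =1 id) ->
    forall z, P (hl_map L n z) = hl_map L n (tensor_op_upto T n z).
Proof.
move=> [m T1]; have [c c0 Tc] := tensor_op_upto_bound T1.
(* Only levels [n >= m] enter, because the constant [c] is valid there. *)
pose G (x y : L) := exists n (z : HN n), [/\ (m <= n)%N, x = hl_map L n z &
  y = hl_map L n (tensor_op_upto T n z)].
have [|||P [_ PG]] := @bounded_extension _ L G c c0.
- move=> a x y x' y' [n [z [mn -> ->]]] [n' [z' [mn' -> ->]]].
  have T1n j : (n < j)%N -> T j =1 id by move=> /(leq_ltn_trans mn); exact: T1.
  have T1n' j : (n' < j)%N -> T j =1 id by move=> /(leq_ltn_trans mn'); exact: T1.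
  have [u [<- <-]] := hl_map_lift z (leq_maxl n n') T1n.
  have [v [<- <-]] := hl_map_lift z' (leq_maxr n n') T1n'.
  exists (maxn n n'), (a *: u + v); split; rewrite ?linearP//.
  exact: leq_trans mn (leq_maxl _ _).
- by move=> x y [n [z [mn -> ->]]]; rewrite !hl_isometry; exact: Tc.
- rewrite -subTset -(hl_dense L) => x; apply: closure_subset => _ [n _ [z _ <-]].
  have [u uz] := hl_map_embed z (leq_maxr m n).
  exists (hl_map L (maxn m n) (tensor_op_upto T (maxn m n) u)), (maxn m n), u.
  by rewrite leq_maxl uz.
(* [n] may be smaller than [m]; the vector is then lifted to a level covered by [G]. *)
exists P => n T1n z.
have [z' [<- <-]] := hl_map_lift z (leq_maxr m n) T1n.
by apply: PG; exists (maxn m n), z'; split=> //; exact: leq_maxl.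
Qed.

End restricted_operator.

Section restricted_tensor_operator.
Context (R : realType) (tens : forall A B : hilbertType R, hilbert_tensor A B).
Context (H : nat -> hilbertType R) (w : forall j, H j).
Context (L : restricted_tensor tens w).
Context (d : nat -> measure_display) (S : forall j, measurableType (d j)).
Context (t : forall j, S j) (pi : forall j, S j -> bounded_op (H j)).
Hypothesis pi_t : forall j (x : H j), pi (t j) x = x.

(** The property selected by [get] concerns elementary tensors only. [D] is shown to be inhabited,
    so that [get] does not return its default, and agreement then spreads to all [z] by totality. *)
Lemma restricted_tensor_opE (s : rprod t) n z :
  (forall j, (n < j)%N -> rprod_val s j = t j) ->
  restricted_tensor_op L t pi s (hl_map L n z) =
  hl_map L n (tensor_op_upto tens (fun j => pi (rprod_val s j)) n z).
Proof.
move=> sn; set T := fun j => pi (rprod_val s j).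
have T1 m : (forall j, (m < j)%N -> rprod_val s j = t j) ->
    forall j, (m < j)%N -> T j =1 id.
  by move=> sm j mj x; rewrite /T sm// pi_t.
have [P PE] : exists P : bounded_op L, forall n,
    (forall j, (n < j)%N -> T j =1 id) ->
    forall z, P (hl_map L n z) = hl_map L n (tensor_op_upto tens T n z).
  by apply: restricted_op_exists; exists n; exact: T1.
pose D := [set P : bounded_op L | forall M : nat,
    (forall j, (M < j)%N -> rprod_val s j = t j) ->
    forall x : (forall j, H j), P (hl_map L M (tensor_vect tens M x)) =
      hl_map L M (tensor_vect tens M (fun j => T j (x j)))].
have : D (restricted_tensor_op L t pi s).
  apply: getPex; exists P => M sM x; rewrite PE; last exact: T1.
  by rewrite tensor_op_upto_vect.
move: (restricted_tensor_op L t pi s) => Q DQ.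
have [q q0 Qq] := bounded_op_bound Q.
have [c c0 Tc] := bounded_op_bound (tensor_op_upto tens T n).
apply/eqP; rewrite -subr_eq0; apply/eqP; move: z.
apply: (@tensor_upto_total _ tens H n L _ (q + c)).
- by move=> a x y; rewrite /= !linearP /= scalerDr addrACA.
- move=> x; apply: (le_trans (ler_normB _ _)); rewrite mulrDl lerD//.
    by apply: (le_trans (Qq _)); rewrite hl_isometry.
  by rewrite hl_isometry.
- by move=> x; rewrite DQ// tensor_op_upto_vect subrr.
Qed.

End restricted_tensor_operator.

(** * Complex-valued integrals and L2 bounds *)

Section complex_parts.
Context (R : realType).
Implicit Types (z : R[i]).

Lemma ReD z z' : complex.Re (z + z') = complex.Re z + complex.Re z'.
Proof. by case: z z' => [a b] [c d]. Qed.

Lemma ImD z z' : complex.Im (z + z') = complex.Im z + complex.Im z'.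
Proof. by case: z z' => [a b] [c d]. Qed.

Lemma ReM z z' : complex.Re (z * z') =
  complex.Re z * complex.Re z' - complex.Im z * complex.Im z'.
Proof. by case: z z' => [a b] [c d]. Qed.

Lemma ImM z z' : complex.Im (z * z') =
  complex.Re z * complex.Im z' + complex.Im z * complex.Re z'.
Proof. by case: z z' => [a b] [c d]. Qed.

Lemma Re_conj z : complex.Re z^* = complex.Re z.
Proof. by case: z. Qed.

Lemma Im_conj z : complex.Im z^* = - complex.Im z.
Proof. by case: z. Qed.

Lemma ger0_Re z : 0 <= z -> z = (complex.Re z)%:C%C.
Proof. by case: z => a b; rewrite lecE /= => /andP[/eqP ->]. Qed.

Lemma ler_Re z z' : z <= z' -> complex.Re z <= complex.Re z'.
Proof. by rewrite lecE => /andP[]. Qed.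

Lemma rn_ge0 z : 0 <= rn z.
Proof. exact: ler_Re (normr_ge0 z). Qed.

Lemma rnD z z' : rn (z + z') <= rn z + rn z'.
Proof. by rewrite -ReD; apply: ler_Re; exact: ler_normD. Qed.

Lemma rnM z z' : rn (z * z') = rn z * rn z'.
Proof.
by rewrite normrM (ger0_Re (normr_ge0 z)) (ger0_Re (normr_ge0 z')) -rmorphM.
Qed.

Lemma rn_conj z : rn z^* = rn z.
Proof. by rewrite norm_conjC. Qed.

Lemma rn_sqr z : rn z ^+ 2 = complex.Re z ^+ 2 + complex.Im z ^+ 2.
Proof. by case: z => a b; rewrite normc_def /= sqr_sqrtr// addr_ge0 ?sqr_ge0. Qed.

Lemma normr_Re_le z : `|complex.Re z| <= rn z.
Proof.
rewrite -(@ler_pXn2r _ 2)// ?nnegrE ?rn_ge0// rn_sqr real_normK ?num_real//.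
by rewrite lerDl sqr_ge0.
Qed.

Lemma normr_Im_le z : `|complex.Im z| <= rn z.
Proof.
rewrite -(@ler_pXn2r _ 2)// ?nnegrE ?rn_ge0// rn_sqr real_normK ?num_real//.
by rewrite lerDr sqr_ge0.
Qed.

Lemma rn_le_parts z : rn z <= `|complex.Re z| + `|complex.Im z|.
Proof.
rewrite -(@ler_pXn2r _ 2)// ?nnegrE ?rn_ge0 ?addr_ge0// rn_sqr sqrrD.
rewrite !real_normK ?num_real// addrAC lerDl.
by rewrite mulrn_wge0// mulr_ge0.
Qed.

Lemma Re_sum I r (P : pred I) (F : I -> R[i]) :
  complex.Re (\sum_(i <- r | P i) F i) = \sum_(i <- r | P i) complex.Re (F i).
Proof. by apply: (big_morph _ ReD). Qed.

Lemma cvg_Re (z_ : nat -> CC R) (z : CC R) : z_ @ \oo --> z ->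
  complex.Re (z_ n) @[n --> \oo] --> complex.Re z.
Proof.
move=> zz; apply/cvgrPdist_le => e e0.
have e0' : 0 < e%:C%C by rewrite ltcR.
have /cvgrPdist_le/(_ _ e0') := zz; apply: filterS => n.
rewrite lecE /= => /andP[_]; apply: le_trans.
by apply: le_trans (normr_Re_le _); rewrite ReD; case: (z_ n).
Qed.

Lemma cvg_Im (z_ : nat -> CC R) (z : CC R) : z_ @ \oo --> z ->
  complex.Im (z_ n) @[n --> \oo] --> complex.Im z.
Proof.
move=> zz; apply/cvgrPdist_le => e e0.
have e0' : 0 < e%:C%C by rewrite ltcR.
have /cvgrPdist_le/(_ _ e0') := zz; apply: filterS => n.
rewrite lecE /= => /andP[_]; apply: le_trans.
by apply: le_trans (normr_Im_le _); rewrite ImD; case: (z_ n).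
Qed.

Let cvg_normK (K : numFieldType) (z_ : nat -> K) (z : K) : z_ @ \oo --> z ->
  `|z_ n| @[n --> \oo] --> `|z|.
Proof. exact: cvg_norm. Qed.

Lemma cvg_rn (z_ : nat -> CC R) (z : CC R) : z_ @ \oo --> z ->
  rn (z_ n) @[n --> \oo] --> rn z.
Proof. by move=> zz; exact: cvg_Re (cvg_normK zz). Qed.

End complex_parts.

Section complex_measurable.
Context d (T : measurableType d) (R : realType).
Implicit Types (f g : T -> R[i]).

Lemma cmeasurable_rn f : cmeasurable f -> measurable_fun setT (fun x => rn (f x)).
Proof.
move=> [mRe mIm].
have -> : (fun x => rn (f x)) =
    (fun x => Num.sqrt (complex.Re (f x) ^+ 2 + complex.Im (f x) ^+ 2)).
  apply/funext => x; rewrite -rn_sqr sqrtr_sqr; apply/esym/ger0_norm.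
  exact: rn_ge0.
apply: measurableT_comp.
  by apply: continuous_measurable_fun; exact: sqrt_continuous.
by apply: measurable_funD; exact: measurable_funX.
Qed.

Lemma cmeasurableD f g : cmeasurable f -> cmeasurable g ->
  cmeasurable (fun x => f x + g x).
Proof.
move=> [fr fi] [gr gi]; split.
- by under eq_fun do rewrite ReD; exact: measurable_funD.
- by under eq_fun do rewrite ImD; exact: measurable_funD.
Qed.

Lemma cmeasurableM f g : cmeasurable f -> cmeasurable g ->
  cmeasurable (fun x => f x * g x).
Proof.
move=> [fr fi] [gr gi]; split.
- by under eq_fun do rewrite ReM; apply: measurable_funB; exact: measurable_funM.
- by under eq_fun do rewrite ImM; apply: measurable_funD; exact: measurable_funM.
Qed.

Lemma cmeasurable_cst (c : R[i]) : cmeasurable (fun _ : T => c).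
Proof. by split; exact: measurable_cst. Qed.

Lemma cmeasurable_sum I (r : seq I) (f_ : I -> T -> R[i]) :
  (forall i, cmeasurable (f_ i)) -> cmeasurable (fun x => \sum_(i <- r) f_ i x).
Proof.
move=> mf; elim: r => [|i r IHr].
  by under eq_fun do rewrite big_nil; exact: cmeasurable_cst.
by under eq_fun do rewrite big_cons; exact: cmeasurableD.
Qed.

Lemma cmeasurable_conj f : cmeasurable f -> cmeasurable (fun x => (f x)^*).
Proof.
move=> [fr fi]; split; first by under eq_fun do rewrite Re_conj.
by under eq_fun do rewrite Im_conj; exact: measurableT_comp.
Qed.

Lemma cmeasurable_comp d' (T' : measurableType d') (h : T' -> T) f :
  measurable_fun setT h -> cmeasurable f -> cmeasurable (fun x => f (h x)).
Proof.
move=> mh [fr fi]; split.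
- exact: (measurableT_comp fr mh).
- exact: (measurableT_comp fi mh).
Qed.

Lemma cmeasurable_cvg (f_ : nat -> T -> R[i]) f :
  (forall n, cmeasurable (f_ n)) ->
  (forall x, f_ n x @[n --> \oo] --> (f x : CC R)) -> cmeasurable f.
Proof.
move=> mf ff; split.
- apply: (measurable_fun_cvg (h := fun n x => complex.Re (f_ n x))).
    by move=> n; case: (mf n).
  by move=> x _; exact: cvg_Re.
- apply: (measurable_fun_cvg (h := fun n x => complex.Im (f_ n x))).
    by move=> n; case: (mf n).
  by move=> x _; exact: cvg_Im.
Qed.

End complex_measurable.

Section complex_integral.
Context d (T : measurableType d) (R : realType).
Variable mu : {measure set T -> \bar R}.
Implicit Types (f g : T -> R[i]) (c k : R[i]).

Definition has_cintegral f c := cintegrable mu f /\ cintegral mu f = c.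

Lemma has_cintegralP f c : has_cintegral f c <->
  [/\ cintegrable mu f, \int[mu]_x complex.Re (f x) = complex.Re c &
      \int[mu]_x complex.Im (f x) = complex.Im c].
Proof.
split=> [[fi <-]|[fi fr fim]]; first by [].
by split=> //; rewrite /cintegral fr fim; case: c {fr fim}.
Qed.

Lemma has_cintegralD f g a b : has_cintegral f a -> has_cintegral g b ->
  has_cintegral (fun x => f x + g x) (a + b).
Proof.
move=> /has_cintegralP[[fr fi] ra ia] /has_cintegralP[[gr gi] rb ib].
apply/has_cintegralP; split.
- split.
  + by under eq_fun do rewrite ReD EFinD; exact: integrableD.
  + by under eq_fun do rewrite ImD EFinD; exact: integrableD.
- by under eq_Rintegral do rewrite ReD; rewrite RintegralD// ra rb ReD.
- by under eq_Rintegral do rewrite ImD; rewrite RintegralD// ia ib ImD.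
Qed.

Lemma has_cintegral0 : has_cintegral (fun=> 0) 0.
Proof.
apply/has_cintegralP; split; rewrite /= ?Rintegral_cst ?mul0r//.
by split; exact: integrable0.
Qed.

Lemma has_cintegral_sum I (r : seq I) (f_ : I -> T -> R[i]) (c_ : I -> R[i]) :
  (forall i, has_cintegral (f_ i) (c_ i)) ->
  has_cintegral (fun x => \sum_(i <- r) f_ i x) (\sum_(i <- r) c_ i).
Proof.
move=> fc; elim: r => [|i r IHr].
  by under eq_fun do rewrite big_nil; rewrite big_nil; exact: has_cintegral0.
under eq_fun do rewrite big_cons; rewrite big_cons.
exact: has_cintegralD.
Qed.

End complex_integral.

Lemma limn_einf_le_cvg (R : realType) (u v : nat -> \bar R) (l : \bar R) :
  (forall n, u n <= v n)%E -> v @ \oo --> l -> (limn_einf u <= l)%E.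
Proof.
move=> uv vl; rewrite limn_einf_lim -(cvg_lim _ vl)//.
apply: lee_lim; [exact: is_cvg_einfs|by apply/cvg_ex; exists l|].
apply: nearW => n; apply: le_trans (uv n).
by apply: ereal_inf_lbound; exists n => /=.
Qed.

Section L2_bounds.
Context d (T : measurableType d) (R : realType).
Variable mu : {measure set T -> \bar R}.
Implicit Types (f g : T -> R[i]) (h : T -> R) (a b : R).

(** Minkowski and Hoelder speak of the norm, Fatou and the change of variables of the integral of
    the square; this passes between the two. *)
Lemma Lnorm2_le h a : 0 <= a ->
  ('N[mu]_2%:E [EFin \o h] <= a%:E)%E <->
  (\int[mu]_x (h x ^+ 2)%:E <= (a ^+ 2)%:E)%E.
Proof.
move=> a0; have N2 : ('N[mu]_2%:E [EFin \o h] `^ 2 = \int[mu]_x (h x ^+ 2)%:E)%E.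
  rewrite poweR_Lnorm//; apply: eq_integral => x _ /=.
  by rewrite powR_mulrn// real_normK ?num_real.
have a2 : (a%:E `^ 2 = (a ^+ 2)%:E)%E by rewrite poweR_EFin powR_mulrn.
have N0 : (0 <= 'N[mu]_2%:E [EFin \o h])%E by exact: Lnorm_ge0.
split=> [Na|].
  by rewrite -N2 -a2; apply: gt0_ler_poweR => //; rewrite in_itv /= ?N0 ?lee_fin ?a0 leey.
rewrite -N2 -a2 => Na.
have h0 : (0 <= 2^-1 :> R) by rewrite invr_ge0.
have ge0 (y : \bar R) : (y `^ 2)%E \in `[0%E, +oo%E] by rewrite in_itv /= poweR_ge0 leey.
have := gt0_ler_poweR h0 (ge0 _) (ge0 _) Na.
by rewrite -!poweRrM divff ?pnatr_eq0// !poweRe1 ?lee_fin.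
Qed.

Definition L2_le f a := [/\ cmeasurable f, 0 <= a &
  (\int[mu]_x (rn (f x) ^+ 2)%:E <= (a ^+ 2)%:E)%E].

Lemma L2_le_trans f a b : a <= b -> L2_le f a -> L2_le f b.
Proof.
move=> ab [mf a0 fa]; split=> //; first exact: le_trans ab.
apply: (le_trans fa); rewrite lee_fin ler_pXn2r// ?nnegrE//.
exact: le_trans ab.
Qed.

Lemma L2_leD f g a b : L2_le f a -> L2_le g b ->
  L2_le (fun x => f x + g x) (a + b).
Proof.
move=> [mf a0 fa] [mg b0 gb]; have ab0 : 0 <= a + b by exact: addr_ge0.
split=> //; first exact: cmeasurableD.
have mrf := cmeasurable_rn mf; have mrg := cmeasurable_rn mg.
apply: (@le_trans _ _ (\int[mu]_x ((rn (f x) + rn (g x)) ^+ 2)%:E)%E).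
  apply: ge0_le_integral => //.
  - by move=> x _; rewrite lee_fin sqr_ge0.
  - apply/measurable_EFinP; apply: measurable_funX.
    by apply: cmeasurable_rn; exact: cmeasurableD.
  - by apply/measurable_EFinP; apply: measurable_funX; exact: measurable_funD.
  - move=> x _; rewrite lee_fin ler_pXn2r ?nnegrE ?rn_ge0 ?addr_ge0 ?rn_ge0//.
    exact: rnD.
apply/(Lnorm2_le (fun x => rn (f x) + rn (g x)) ab0).
apply: (le_trans (minkowski_EFin mu mrf mrg _)); first by rewrite ler1n.
rewrite [leRHS]EFinD; apply: leeD.
- exact/(Lnorm2_le (fun x => rn (f x)) a0).
- exact/(Lnorm2_le (fun x => rn (g x)) b0).
Qed.

Lemma L2_le0 : L2_le (fun=> 0) 0.
Proof.
split=> [||]; [exact: cmeasurable_cst|exact: lexx|].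
by under eq_integral do rewrite normr0 /= expr0n; rewrite integral0 expr0n.
Qed.

Lemma L2_le_sum I (r : seq I) (f_ : I -> T -> R[i]) (a_ : I -> R) :
  (forall i, L2_le (f_ i) (a_ i)) ->
  L2_le (fun x => \sum_(i <- r) f_ i x) (\sum_(i <- r) a_ i).
Proof.
move=> fa; elim: r => [|i r IHr].
  by under eq_fun do rewrite big_nil; rewrite big_nil; exact: L2_le0.
by under eq_fun do rewrite big_cons; rewrite big_cons; exact: L2_leD.
Qed.

Lemma L2_le_lim (f_ : nat -> T -> R[i]) f (a_ : nat -> R) a :
  (forall n, L2_le (f_ n) (a_ n)) ->
  (forall x, f_ n x @[n --> \oo] --> (f x : CC R)) ->
  a_ @ \oo --> a -> L2_le f a.
Proof.
move=> fa ff aa; have mf : cmeasurable f.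
  by apply: (@cmeasurable_cvg _ _ _ f_) => // n; case: (fa n).
split=> //.
  rewrite -(cvg_lim (@Rhausdorff R) aa).
  apply: limr_ge; first by apply/cvg_ex; exists a.
  by apply: nearW => n; case: (fa n).
have rcvg x : rn (f_ n x) ^+ 2 @[n --> \oo] --> rn (f x) ^+ 2.
  have : rn (f_ n x) @[n --> \oo] --> rn (f x).
    exact: cvg_rn (ff x).
  by move=> h; rewrite expr2; under eq_fun do rewrite expr2; exact: cvgM.
have -> : (\int[mu]_x (rn (f x) ^+ 2)%:E =
    \int[mu]_x limn_einf (fun n => (rn (f_ n x) ^+ 2)%:E))%E.
  apply: eq_integral => x _; apply/esym.
  have c : (rn (f_ n x) ^+ 2)%:E @[n --> \oo] --> (rn (f x) ^+ 2)%:E.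
    by apply: cvg_EFin; [exact: nearW|exact: rcvg].
  by case: (cvg_limn_einf_sup c).
apply: (le_trans (fatou mu measurableT _ _)).
- move=> n; apply/measurable_EFinP; apply: measurable_funX.
  by apply: cmeasurable_rn; case: (fa n).
- by move=> n x _; rewrite lee_fin sqr_ge0.
apply: (@limn_einf_le_cvg _ _ (fun n => (a_ n ^+ 2)%:E)).
  by move=> n; case: (fa n).
apply: cvg_EFin; first exact: nearW.
by rewrite expr2; under eq_fun do rewrite expr2; exact: cvgM.
Qed.

(* The factor 2 comes from bounding the real and imaginary parts separately. *)
Lemma L2_le_mul f g a b : L2_le f a -> L2_le g b ->
  cintegrable mu (fun x => f x * (g x)^*) /\
  rn (cintegral mu (fun x => f x * (g x)^*)) <= 2 * (a * b).
Proof.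
move=> [mf a0 fa] [mg b0 gb].
have mrf := cmeasurable_rn mf; have mrg := cmeasurable_rn mg.
have [mr mi] : cmeasurable (fun x => f x * (g x)^*).
  by apply: cmeasurableM => //; exact: cmeasurable_conj.
have hol : (\int[mu]_x (rn (f x) * rn (g x))%:E <= (a * b)%:E)%E.
  have h2 : (2^-1 + 2^-1 = 1 :> R) by rewrite [RHS]splitr !div1r.
  have := hoelder mu mrf mrg (ltr0Sn _ 1) (ltr0Sn _ 1) h2.
  rewrite Lnorm1 /= => h; apply: le_trans (le_trans h _).
    apply: ge0_le_integral => //=.
    - by move=> x _; rewrite lee_fin mulr_ge0 ?rn_ge0.
    - by apply/measurable_EFinP; exact: measurable_funM.
    - by apply/measurable_EFinP; apply: measurableT_comp => //; exact: measurable_funM.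
    - by move=> x _; rewrite lee_fin ler_norm.
  rewrite EFinM; apply: lee_pmul => //; try exact: Lnorm_ge0.
  - exact/(Lnorm2_le (fun x => rn (f x)) a0).
  - exact/(Lnorm2_le (fun x => rn (g x)) b0).
have part (h : T -> R) : measurable_fun setT h ->
    (forall x, `|h x| <= rn (f x) * rn (g x)) ->
    mu.-integrable setT (fun x => (h x)%:E) /\ `|\int[mu]_x h x| <= a * b.
  move=> mh hfg; have H : (\int[mu]_x `|(h x)%:E| <= (a * b)%:E)%E.
    apply: le_trans hol; apply: ge0_le_integral => //.
    - by apply: measurableT_comp => //; exact/measurable_EFinP.
    - by apply/measurable_EFinP; exact: measurable_funM.
    - by move=> x _; rewrite lee_fin.
  have ih : mu.-integrable setT (fun x => (h x)%:E).
    apply/integrableP; split; first exact/measurable_EFinP.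
    by apply: (le_lt_trans H); rewrite ltry.
  split=> //; rewrite -lee_fin EFin_normr_Rintegral//.
  by apply: le_trans H; apply: le_abse_integral => //; exact/measurable_EFinP.
have bound x : rn (f x * (g x)^*) = rn (f x) * rn (g x) by rewrite rnM rn_conj.
have [ir br] : mu.-integrable setT (fun x => (complex.Re (f x * (g x)^*))%:E) /\
    `|\int[mu]_x complex.Re (f x * (g x)^*)| <= a * b.
  by apply: part => // x; rewrite -bound normr_Re_le.
have [ii bi] : mu.-integrable setT (fun x => (complex.Im (f x * (g x)^*))%:E) /\
    `|\int[mu]_x complex.Im (f x * (g x)^*)| <= a * b.
  by apply: part => // x; rewrite -bound normr_Im_le.
split=> //; apply: (le_trans (rn_le_parts _)).
by rewrite mulr2n mulrDl mul1r lerD.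
Qed.

Lemma has_cintegral_L2_le f a : cmeasurable f -> 0 <= a ->
  has_cintegral mu (fun x => f x * (f x)^*) (a ^+ 2)%:C%C -> L2_le f a.
Proof.
move=> mf a0 /has_cintegralP[[ir _] /= e _]; split=> //.
rewrite -e /Rintegral fineK ?integrable_fin_num//.
rewrite le_eqVlt; apply/orP; left; apply/eqP; apply: eq_integral => x _.
congr EFin.
by rewrite rn_sqr; case: (f x) => u v /=; rewrite mulrN opprK !expr2.
Qed.

End L2_bounds.

(** * Square integrability by density *)

Section hilbert_rn.
Context (R : realType) (H : hilbertType R).
Implicit Types (u v : H).

Lemma hrn_ge0 u : 0 <= rn u.
Proof. exact: ler_Re (normr_ge0 u). Qed.

Lemma hnormE u : `|u| = (rn u)%:C%C.
Proof. exact: ger0_Re (normr_ge0 u). Qed.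

Lemma inner_rn u : inner u u = (rn u ^+ 2)%:C%C.
Proof. by rewrite inner_normE hnormE rmorphXn. Qed.

Lemma cvg_hrn (u_ : nat -> H) u : u_ @ \oo --> u -> rn (u_ n) @[n --> \oo] --> rn u.
Proof.
move=> uu; have h : `|u_ n| @[n --> \oo] --> (`|u| : CC R) by exact: cvg_norm.
exact: cvg_Re h.
Qed.

Lemma cvg_hrnB (u_ : nat -> H) u : u_ @ \oo --> u ->
  rn (u - u_ n) @[n --> \oo] --> (0 : R).
Proof.
move=> uu; have -> : (0 : R) = rn (u - u) by rewrite subrr normr0.
by apply: cvg_hrn; apply: cvgB => //; exact: cvg_cst.
Qed.

Lemma closure_seqT (D : set H) u : closure D = setT ->
  exists u_ : nat -> H, (forall n, D (u_ n)) /\ u_ @ \oo --> u.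
Proof. by move=> DT; apply: closure_seq; rewrite DT. Qed.

End hilbert_rn.

Section L2_contractive.
Context d (T : measurableType d) (R : realType) (H : hilbertType R).
Implicit Types (mu : {measure set T -> \bar R}) (pi : T -> bounded_op H).

(** What remains of [SQ] after tensoring with an identity: its equality at [u1 = u2], [v1 = v2]
    becomes an upper bound. *)
Definition L2_contractive mu pi := forall u v : H,
  L2_le mu (fun s => inner (pi s u) v) (rn u * rn v).

Lemma L2_contractive_dense mu pi (D : set H) : closure D = setT ->
  (forall u v, D u -> D v -> L2_le mu (fun s => inner (pi s u) v) (rn u * rn v)) ->
  L2_contractive mu pi.
Proof.
move=> DT DP u v.
have [u_ [Du uu]] := closure_seqT u DT.
have [v_ [Dv vv]] := closure_seqT v DT.
apply: (@L2_le_lim _ _ _ _ (fun n s => inner (pi s (u_ n)) (v_ n)) _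
  (fun n => rn (u_ n) * rn (v_ n))).
- by move=> n; exact: DP.
- by move=> s; apply: cvg_inner => //; exact: cvg_bounded_op.
- by apply: cvgM; exact: cvg_hrn.
Qed.

Lemma SQ_integrandE pi u1 v1 u2 v2 : SQ_integrand pi u1 v1 u2 v2 =
  fun s => inner (pi s u1) v1 * (inner (pi s u2) v2)^*.
Proof. by apply/funext => s; rewrite /SQ_integrand -innerC. Qed.

(** At [u1 = u2] and [v1 = v2] the identity gives the exact L2 norm of the coefficient; density
    carries the inequality to all vectors. *)
Lemma SQ_L2_contractive mu pi (D : set H) : closure D = setT ->
  (forall u v, D u -> D v -> cmeasurable (fun s => inner (pi s u) v)) ->
  (forall u1 v1 u2 v2, D u1 -> D v1 -> D u2 -> D v2 ->
    has_cintegral mu (SQ_integrand pi u1 v1 u2 v2) (inner u1 u2 * inner v2 v1)) ->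
  L2_contractive mu pi.
Proof.
move=> DT mD iD; apply: (L2_contractive_dense DT) => u v Du Dv.
apply: has_cintegral_L2_le; first exact: mD.
  by rewrite mulr_ge0 ?hrn_ge0.
have := iD _ _ _ _ Du Dv Du Dv.
by rewrite !inner_rn -rmorphM -exprMn SQ_integrandE.
Qed.

Lemma L2_contractive_integrable mu pi u1 v1 u2 v2 : L2_contractive mu pi ->
  cintegrable mu (SQ_integrand pi u1 v1 u2 v2).
Proof.
by move=> cpi; rewrite SQ_integrandE; case: (L2_le_mul (cpi u1 v1) (cpi u2 v2)).
Qed.

(** The error of replacing the four vectors one at a time. No measure occurs in it, so the estimate
    is uniform along a sequence of measures. The factors 2 are those of [L2_le_mul]. *)
Let err (u1 v1 u2 v2 u1' v1' u2' v2' : H) : R :=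
  2 * ((rn (u1 - u1') * rn v1 + rn u1' * rn (v1 - v1')) * (rn u2 * rn v2)) +
  2 * ((rn u1' * rn v1') * (rn (u2 - u2') * rn v2 + rn u2' * rn (v2 - v2'))).

Lemma cintegral_SQ_integrand_dist mu pi u1 v1 u2 v2 u1' v1' u2' v2' :
  L2_contractive mu pi ->
  rn (cintegral mu (SQ_integrand pi u1 v1 u2 v2) -
      cintegral mu (SQ_integrand pi u1' v1' u2' v2')) <=
  err u1 v1 u2 v2 u1' v1' u2' v2'.
Proof.
move=> cpi; pose f u v s := inner (pi s u) v.
(* The difference of two coefficients, written so that both terms are again coefficients of [pi] and
   hence obey the L2 bound. *)
pose df u v u' v' s := f (u - u') v s + f u' (v - v') s.
have dfE u v u' v' s : f u v s = f u' v' s + df u v u' v' s.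
  have h : pi s (u - u') = pi s u - pi s u' := linearB (pi s) u u'.
  rewrite /df /f h innerBl innerBr; ring.
have dfL u v u' v' : L2_le mu (df u v u' v')
    (rn (u - u') * rn v + rn u' * rn (v - v')).
  exact: L2_leD (cpi _ _) (cpi _ _).
have [i1 b1] := L2_le_mul (dfL u1 v1 u1' v1') (cpi u2 v2).
have [i2 b2] := L2_le_mul (cpi u1' v1') (dfL u2 v2 u2' v2').
have [i3 _] := L2_le_mul (cpi u1' v1') (cpi u2' v2').
have [_ E] := has_cintegralD (conj i3 erefl)
  (has_cintegralD (conj i1 erefl) (conj i2 erefl)).
have -> : SQ_integrand pi u1 v1 u2 v2 = fun s => f u1' v1' s * (f u2' v2' s)^* +
    (df u1 v1 u1' v1' s * (f u2 v2 s)^* + f u1' v1' s * (df u2 v2 u2' v2' s)^*).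
  rewrite SQ_integrandE; apply/funext => s; rewrite -!/(f _ _ s).
  rewrite (dfE u1 v1 u1' v1') (dfE u2 v2 u2' v2') !rmorphD.
  by rewrite !mulrDl !mulrDr; ring.
have -> : SQ_integrand pi u1' v1' u2' v2' = fun s => f u1' v1' s * (f u2' v2' s)^*.
  exact: SQ_integrandE.
rewrite E addrC addKr; apply: (le_trans (rnD _ _)); exact: lerD.
Qed.

(** Since the error is uniform in [n], the approximating vectors can be fixed first and [n] taken
    large afterwards. *)
Lemma square_integrable_seq_dense (mu_ : nat -> {measure set T -> \bar R}) pi
    (D : set H) : closure D = setT ->
  (forall n, L2_contractive (mu_ n) pi) ->
  (forall u1 v1 u2 v2, D u1 -> D v1 -> D u2 -> D v2 -> \forall n \near \oo,
    cintegral (mu_ n) (SQ_integrand pi u1 v1 u2 v2) = inner u1 u2 * inner v2 v1) ->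
  square_integrable_seq mu_ pi.
Proof.
move=> DT cpi DP u1 v1 u2 v2.
split; first by move=> n; exact: L2_contractive_integrable.
have [u1_ [Du1 uu1]] := closure_seqT u1 DT.
have [v1_ [Dv1 vv1]] := closure_seqT v1 DT.
have [u2_ [Du2 uu2]] := closure_seqT u2 DT.
have [v2_ [Dv2 vv2]] := closure_seqT v2 DT.
pose e k := err u1 v1 u2 v2 (u1_ k) (v1_ k) (u2_ k) (v2_ k).
have e0 : e @ \oo --> (0 : R).
  rewrite -[0](_ : 2 * ((0 * rn v1 + rn u1 * 0) * (rn u2 * rn v2)) +
    2 * ((rn u1 * rn v1) * (0 * rn v2 + rn u2 * 0)) = 0); last by ring.
  apply: cvgD; apply: cvgM; [exact: cvg_cst| |exact: cvg_cst|].
  - apply: cvgM; last exact: cvg_cst.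
    apply: cvgD; apply: cvgM; [exact: cvg_hrnB|exact: cvg_cst|exact: cvg_hrn|
      exact: cvg_hrnB].
  - apply: cvgM; first by apply: cvgM; exact: cvg_hrn.
    apply: cvgD; apply: cvgM; [exact: cvg_hrnB|exact: cvg_cst|exact: cvg_hrn|
      exact: cvg_hrnB].
pose c k : CC R := inner (u1_ k) (u2_ k) * inner (v2_ k) (v1_ k).
have cc : c @ \oo --> (inner u1 u2 * inner v2 v1 : CC R).
  by apply: cvgM; exact: cvg_inner.
apply/(@cvgrPdist_le (CC R) (CC R)) => -[a b].
(* A positive complex number is real, so the radius is [a]. *)
rewrite ltcE /= => /andP[/eqP -> a0].
have a20 : 0 < a / 2 by rewrite divr_gt0.
have a20' : 0 < (a / 2)%:C%C by rewrite ltcR.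
have [k [ek ck]] : exists k, e k <= a / 2 /\
    `|inner u1 u2 * inner v2 v1 - c k| <= (a / 2)%:C%C.
  have /cvgrPdist_le/(_ _ a20) h1 := e0.
  have /cvgrPdist_le/(_ _ a20') h2 := cc.
  have [k [/= k1 k2]] := filter_ex (filterI h1 h2); exists k; split=> //.
  by apply: le_trans k1; rewrite sub0r normrN ler_norm.
apply: filterS (DP _ _ _ _ (Du1 k) (Dv1 k) (Du2 k) (Dv2 k)) => n nE.
(* For this [n] the integral at the approximating vectors is exactly [c k], so inserting it costs
   nothing. *)
have -> : inner u1 u2 * inner v2 v1 - cintegral (mu_ n) (SQ_integrand pi u1 v1 u2 v2)
   = (inner u1 u2 * inner v2 v1 - c k) -
    (cintegral (mu_ n) (SQ_integrand pi u1 v1 u2 v2) -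
      cintegral (mu_ n) (SQ_integrand pi (u1_ k) (v1_ k) (u2_ k) (v2_ k))).
  by rewrite nE -/(c k); ring.
apply: (le_trans (ler_normB _ _)).
have -> : (a +i* 0)%C = (a / 2)%:C%C + (a / 2)%:C%C by rewrite -rmorphD -splitr.
apply: lerD => //; rewrite (ger0_Re (normr_ge0 _)) lecR.
exact: le_trans (cintegral_SQ_integrand_dist _ _ _ _ _ _ _ _ (cpi n)) ek.
Qed.

(** The sequence version, applied to the constant sequence [mu], has the integral itself as
    limit. *)
Lemma SQ_dense mu pi (D : set H) : closure D = setT ->
  (forall u v, D u -> D v -> cmeasurable (fun s => inner (pi s u) v)) ->
  (forall u1 v1 u2 v2, D u1 -> D v1 -> D u2 -> D v2 ->
    has_cintegral mu (SQ_integrand pi u1 v1 u2 v2) (inner u1 u2 * inner v2 v1)) ->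
  SQ mu pi.
Proof.
move=> DT mD iD; have cpi := SQ_L2_contractive DT mD iD.
split; first by move=> u v; case: (cpi u v).
move=> u1 v1 u2 v2; split; first exact: L2_contractive_integrable.
have [|_ h] := @square_integrable_seq_dense (fun=> mu) pi D DT (fun=> cpi) _ u1 v1 u2 v2.
  by move=> ? ? ? ? ? ? ? ?; apply: nearW => _; apply: (iD _ _ _ _ _ _ _ _).2.
apply: (cvg_unique (@norm_hausdorff (CC R) (CC R)) _ h).
exact: cvg_cst.
Qed.

End L2_contractive.

(** * Square integrability of tensor products *)

Section product_integral.
Context d1 d2 (T1 : measurableType d1) (T2 : measurableType d2) (R : realType).
Variables (m1 : {sigma_finite_measure set T1 -> \bar R})
  (m2 : {sigma_finite_measure set T2 -> \bar R}).

(** Tonelli on absolute values gives the integrability that Fubini needs for the value. *)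
Lemma integrable_prodM (f : T1 -> R) (g : T2 -> R) :
  m1.-integrable setT (fun x => (f x)%:E) ->
  m2.-integrable setT (fun x => (g x)%:E) ->
  (m1 \x m2)%E.-integrable setT (fun p => (f p.1 * g p.2)%:E) /\
  \int[(m1 \x m2)%E]_p (f p.1 * g p.2) = \int[m1]_x f x * \int[m2]_y g y.
Proof.
move=> fi gi; have /integrableP[mf fb] := fi; have /integrableP[mg gb] := gi.
have i : (m1 \x m2)%E.-integrable setT (fun p => (f p.1 * g p.2)%:E).
  apply/integrable12ltyP.
    apply/measurable_EFinP; apply: measurable_funM.
    - by apply: measurableT_comp => //; exact/measurable_EFinP.
    - by apply: measurableT_comp => //; exact/measurable_EFinP.
  have mag : measurable_fun setT (fun y => (`|g y|)%:E).
    apply/measurable_EFinP; apply: measurableT_comp => //.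
    exact/measurable_EFinP.
  have maf : measurable_fun setT (fun x => (`|f x|)%:E).
    apply/measurable_EFinP; apply: measurableT_comp => //.
    exact/measurable_EFinP.
  have E x : (\int[m2]_y `|(f (x, y).1 * g (x, y).2)%:E| =
      (`|f x|)%:E * \int[m2]_y (`|g y|)%:E)%E.
    rewrite -ge0_integralZl//.
    by apply: eq_integral => y _; rewrite /= normrM EFinM.
  under eq_integral do rewrite E.
  rewrite ge0_integralZr//; last by apply: integral_ge0.
  apply: lte_mul_pinfty => //; first exact: integral_ge0.
  by rewrite ge0_fin_numE//; exact: integral_ge0.
split=> //; rewrite /Rintegral -(integral12_prod_meas1 i).
pose G := fine (\int[m2]_y (g y)%:E)%E.
have E x : (\int[m2]_y (f x * g y)%:E = G%:E * (f x)%:E)%E.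
  by rewrite muleC fineK ?integrable_fin_num// -integralZl.
have -> : (\int[m1]_x fubini_F m2 (fun p => (f p.1 * g p.2)%:E) x =
    \int[m1]_x (G%:E * (f x)%:E))%E.
  by apply: eq_integral => x _; exact: E.
by rewrite integralZl// fineM ?integrable_fin_num// mulrC.
Qed.

Lemma has_cintegral_prod (f : T1 -> R[i]) (g : T2 -> R[i]) a b :
  has_cintegral m1 f a -> has_cintegral m2 g b ->
  has_cintegral (m1 \x m2)%E (fun p => f p.1 * g p.2) (a * b).
Proof.
move=> /has_cintegralP[[fr fi] ra ia] /has_cintegralP[[gr gi] rb ib].
have [irr rr] := integrable_prodM fr gr.
have [iri ri] := integrable_prodM fr gi.
have [iir ir] := integrable_prodM fi gr.
have [iii ii] := integrable_prodM fi gi.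
apply/has_cintegralP; split.
- split.
  + by under eq_fun do rewrite ReM EFinB;
    exact: (integrableB measurableT irr iii).
  + by under eq_fun do rewrite ImM EFinD;
    exact: (integrableD measurableT iri iir).
- under eq_Rintegral do rewrite ReM.
  by rewrite RintegralB// rr ii ra ia rb ib ReM.
- under eq_Rintegral do rewrite ImM.
  by rewrite RintegralD// ri ir ra ia rb ib ImM.
Qed.

End product_integral.

Section SQ_sums.
Context d (T : measurableType d) (R : realType) (H : hilbertType R).
Variables (mu : {measure set T -> \bar R}) (pi : T -> bounded_op H).

(** With the four vectors as parameters the identity is additive in each of them, which carries it
    from elementary tensors to finite sums. *)
Definition SQ_at u1 v1 u2 v2 :=
  has_cintegral mu (SQ_integrand pi u1 v1 u2 v2) (inner u1 u2 * inner v2 v1).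

Lemma SQ_at_sum1 I (r : seq I) (u_ : I -> H) v1 u2 v2 :
  (forall i, SQ_at (u_ i) v1 u2 v2) -> SQ_at (\sum_(i <- r) u_ i) v1 u2 v2.
Proof.
move=> h; rewrite /SQ_at inner_suml mulr_suml.
have -> : SQ_integrand pi (\sum_(i <- r) u_ i) v1 u2 v2 =
    fun s => \sum_(i <- r) SQ_integrand pi (u_ i) v1 u2 v2 s.
  by apply/funext => s; rewrite /SQ_integrand linear_sum inner_suml mulr_suml.
exact: has_cintegral_sum.
Qed.

Lemma SQ_at_sum2 I (r : seq I) (v_ : I -> H) u1 u2 v2 :
  (forall i, SQ_at u1 (v_ i) u2 v2) -> SQ_at u1 (\sum_(i <- r) v_ i) u2 v2.
Proof.
move=> h; rewrite /SQ_at inner_sumr mulr_sumr.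
have -> : SQ_integrand pi u1 (\sum_(i <- r) v_ i) u2 v2 =
    fun s => \sum_(i <- r) SQ_integrand pi u1 (v_ i) u2 v2 s.
  by apply/funext => s; rewrite /SQ_integrand inner_sumr mulr_suml.
exact: has_cintegral_sum.
Qed.

Lemma SQ_at_sum3 I (r : seq I) (u_ : I -> H) u1 v1 v2 :
  (forall i, SQ_at u1 v1 (u_ i) v2) -> SQ_at u1 v1 (\sum_(i <- r) u_ i) v2.
Proof.
move=> h; rewrite /SQ_at inner_sumr mulr_suml.
have -> : SQ_integrand pi u1 v1 (\sum_(i <- r) u_ i) v2 =
    fun s => \sum_(i <- r) SQ_integrand pi u1 v1 (u_ i) v2 s.
  by apply/funext => s; rewrite /SQ_integrand linear_sum inner_sumr mulr_sumr.
exact: has_cintegral_sum.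
Qed.

Lemma SQ_at_sum4 I (r : seq I) (v_ : I -> H) u1 v1 u2 :
  (forall i, SQ_at u1 v1 u2 (v_ i)) -> SQ_at u1 v1 u2 (\sum_(i <- r) v_ i).
Proof.
move=> h; rewrite /SQ_at inner_suml mulr_sumr.
have -> : SQ_integrand pi u1 v1 u2 (\sum_(i <- r) v_ i) =
    fun s => \sum_(i <- r) SQ_integrand pi u1 v1 u2 (v_ i) s.
  by apply/funext => s; rewrite /SQ_integrand inner_suml mulr_sumr.
exact: has_cintegral_sum.
Qed.

End SQ_sums.

Section tensor_SQ.
Context d1 d2 (T1 : measurableType d1) (T2 : measurableType d2) (R : realType).
Variables (m1 : {sigma_finite_measure set T1 -> \bar R})
  (m2 : {sigma_finite_measure set T2 -> \bar R}).
Context (H1 H2 : hilbertType R) (X : hilbert_tensor H1 H2).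

Lemma SQ_tensor (A : T1 -> bounded_op H1) (B : T2 -> bounded_op H2) :
  SQ m1 A -> SQ m2 B ->
  SQ (m1 \x m2)%E (fun p => tensor_op X (A p.1) (B p.2)).
Proof.
move=> [mA iA] [mB iB].
apply: (SQ_dense (tensor_sum_dense X)).
  move=> _ _ [s1 _ <-] [s2 _ <-].
  have -> : (fun p => inner (tensor_op X (A p.1) (B p.2) (tensor_sum X s1))
      (tensor_sum X s2)) = (fun p => \sum_(x <- s1) \sum_(y <- s2)
        inner (A p.1 x.1) y.1 * inner (B p.2 x.2) y.2).
    apply/funext => p; rewrite (linear_sum (tensor_op X (A p.1) (B p.2))).
    rewrite inner_suml; apply: eq_bigr => x _; rewrite inner_sumr.
    by apply: eq_bigr => y _; rewrite /= tensor_opE ht_inner.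
  apply: cmeasurable_sum => x; apply: cmeasurable_sum => y.
  apply: cmeasurableM.
  - exact: (cmeasurable_comp measurable_fst (mA x.1 y.1)).
  - exact: (cmeasurable_comp measurable_snd (mB x.2 y.2)).
move=> _ _ _ _ [s1 _ <-] [s2 _ <-] [s3 _ <-] [s4 _ <-].
apply: SQ_at_sum1 => x1; apply: SQ_at_sum2 => y1.
apply: SQ_at_sum3 => x2; apply: SQ_at_sum4 => y2.
rewrite /SQ_at !ht_inner mulrACA.
have := has_cintegral_prod (iA x1.1 y1.1 x2.1 y2.1) (iB x1.2 y1.2 x2.2 y2.2).
congr has_cintegral; apply/funext => p.
by rewrite /SQ_integrand !tensor_opE !ht_inner mulrACA.
Qed.

End tensor_SQ.

Lemma sum_cauchy_schwarz (R : realFieldType) n (a b : 'I_n -> R) :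
  (\sum_k a k * b k) ^+ 2 <= (\sum_k a k ^+ 2) * (\sum_k b k ^+ 2).
Proof.
set S := \sum_k _; set P := \sum_k _; set Q := \sum_k _.
have Q0 : 0 <= Q by apply: sumr_ge0 => k _; exact: sqr_ge0.
(* Up to the factor [Q] this is the component of [a] orthogonal to [b]. If [Q = 0], all [b k]
   vanish. *)
have : 0 <= \sum_k (Q * a k - S * b k) ^+ 2.
  by apply: sumr_ge0 => k _; exact: sqr_ge0.
have -> : \sum_k (Q * a k - S * b k) ^+ 2 = Q * (P * Q - S ^+ 2).
  rewrite (eq_bigr (fun k => Q ^+ 2 * a k ^+ 2 - (Q * S *+ 2) * (a k * b k)
    + S ^+ 2 * b k ^+ 2)); last by move=> k _; ring.
  by rewrite big_split sumrB /= -!mulr_sumr -/P -/Q -/S; ring.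
have [Q00 _|Qn0] := eqVneq Q 0; last first.
  by rewrite pmulr_rge0 ?subr_ge0// lt0r Qn0.
suff -> : S = 0 by rewrite expr0n Q00 mulr0.
rewrite /S big1// => k _.
have /eqP := Q00; rewrite psumr_eq0; last by move=> ? _; exact: sqr_ge0.
move=> /allP/(_ k); rewrite mem_index_enum sqrf_eq0 => /(_ isT)/eqP ->.
by rewrite mulr0.
Qed.

Section tensor_contractive.
Context d (T : measurableType d) (R : realType).
Context (H1 H2 : hilbertType R) (X : hilbert_tensor H1 H2).

Lemma L2_contractive_tensor (mu : {measure set T -> \bar R})
    (A : T -> bounded_op H1) (B : T -> bounded_op H2) :
  (forall s, B s =1 id) -> L2_contractive mu A ->
  L2_contractive mu (fun s => tensor_op X (A s) (B s)).
Proof.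
move=> B1 cA; apply: (L2_contractive_dense (tensor_sum_dense X)).
move=> _ _ [s1 _ <-] [s2 _ <-].
(* One family for both vectors, so that products with different indices vanish. *)
have [n [e [oe es]]] := gram_schmidt (map snd s1 ++ map snd s2).
have se (s : seq (H1 * H2)) : {subset map snd s <= map snd s1 ++ map snd s2} ->
    forall p, p \in s -> p.2 = \sum_(k < n) inner p.2 (e k) *: e k.
  by move=> sub p ps; apply: es; apply: sub; exact: map_f.
rewrite (tensor_sum_orthonormal X (se s1 _)); last first.
  by move=> x xs; rewrite mem_cat xs.
rewrite (tensor_sum_orthonormal X (se s2 _)); last first.
  by move=> x xs; rewrite mem_cat xs orbT.
set u := fun k : nat => \sum_(p <- s1) inner p.2 (e k) *: p.1.
set v := fun k : nat => \sum_(p <- s2) inner p.2 (e k) *: p.1.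
have rnE (z : nat -> H1) : rn (\sum_(k < n) ht_mul X (z k) (e k)) ^+ 2 =
    \sum_(k < n) rn (z k) ^+ 2.
  have := ht_inner_orthonormal X z z oe.
  rewrite inner_rn => /(congr1 (@complex.Re R)) /= ->.
  by rewrite Re_sum; apply: eq_bigr => k _; rewrite inner_rn.
(* Minkowski yields this sum of products; the discrete Cauchy-Schwarz inequality bounds it by the
   product of the two norms. *)
apply: (@L2_le_trans _ _ _ _ _ (\sum_(k < n) rn (u k) * rn (v k))).
  rewrite -(@ler_pXn2r _ 2)// ?nnegrE ?mulr_ge0 ?hrn_ge0//; last first.
    by apply: sumr_ge0 => k _; rewrite mulr_ge0 ?hrn_ge0.
  by rewrite exprMn (rnE u) (rnE v); exact: sum_cauchy_schwarz.
have -> : (fun s => inner (tensor_op X (A s) (B s)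
      (\sum_(k < n) ht_mul X (u k) (e k))) (\sum_(k < n) ht_mul X (v k) (e k))) =
    (fun s => \sum_(k < n) inner (A s (u k)) (v k)).
  apply/funext => s; rewrite (linear_sum (tensor_op X (A s) (B s))).
  rewrite (eq_bigr (fun k : 'I_n => ht_mul X (A s (u k)) (e k))); last first.
    by move=> k _; rewrite /= tensor_opE B1.
  exact: (ht_inner_orthonormal X (fun k => A s (u k)) v oe).
by apply: L2_le_sum => k; exact: cA.
Qed.

End tensor_contractive.

(** * The restricted tensor product *)

Section isometry.
Context (R : realType) (H K : hilbertType R) (f : {linear H -> K}).
Hypothesis f_iso : forall x, `|f x| = `|x|.

(** Polarization recovers the symmetric part of the inner product from norms; replacing [x] by [i x]
    recovers the antisymmetric part. *)
Lemma inner_isometry x y : inner (f x) (f y) = inner x y.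
Proof.
have polar (V : hilbertType R) (u v : V) :
    inner u v + inner v u = `|u + v| ^+ 2 - `|u| ^+ 2 - `|v| ^+ 2.
  by rewrite -!inner_normE !innerDl !innerDr; ring.
have sym u v : inner (f u) (f v) + inner (f v) (f u) = inner u v + inner v u.
  by rewrite !polar -linearD !f_iso.
have e1 := sym x y; have := sym ('i%C *: x) y.
rewrite linearZ !innerZl !innerZr.
have -> : ('i%C : R[i])^* = - 'i%C by apply/eqP; rewrite eq_complex /= oppr0 !eqxx.
move=> e2.
have i0 : ('i%C : R[i]) != 0 by rewrite eq_complex /= oner_eq0 andbF.
have e3 : inner (f x) (f y) - inner (f y) (f x) = inner x y - inner y x.
  by apply: (mulfI i0); rewrite !mulrBr -!mulNr.
have : inner (f x) (f y) *+ 2 = inner x y *+ 2.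
  rewrite !mulr2n; transitivity ((inner (f x) (f y) + inner (f y) (f x)) +
    (inner (f x) (f y) - inner (f y) (f x))); first by ring.
  by rewrite e1 e3; ring.
by move=> /eqP; rewrite -subr_eq0 -mulrnBl mulrn_eq0 /= subr_eq0 => /eqP.
Qed.

End isometry.

Section truncation.
Context (d : nat -> measure_display) (S : forall j, measurableType (d j)).

Fixpoint fprod_trunc (n : nat) (s : forall j, S j) : Defs.fprod S n :=
  match n return Defs.fprod S n with
  | 0 => s 0%N
  | m.+1 => (fprod_trunc m s, s m.+1)
  end.

Context (t : forall j, S j).

Lemma fprod_fill_trunc n s j : (j <= n)%N ->
  fprod_fill t (fprod_trunc n s) j = s j.
Proof.
elim: n => [|n IHn] /=; first by rewrite leqn0 => /eqP ->; rewrite dfwithin.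
rewrite leq_eqVlt => /predU1P[->|jn]; first by rewrite dfwithin.
by rewrite dfwithout ?gtn_eqF//; exact: IHn.
Qed.

Lemma theta_trunc n (s : rprod t) :
  (forall j, (n < j)%N -> rprod_val s j = t j) ->
  theta t (fprod_trunc n (rprod_val s)) = s.
Proof.
case: s => s sP /= st.
have E : fprod_fill t (fprod_trunc n s) = s.
  apply/functional_extensionality_dep => j; have [jn|nj] := leqP j n.
    exact: fprod_fill_trunc.
  by rewrite fprod_fill_out// st.
(* The proof component depends on the function being rewritten, so it is generalized first. *)
rewrite /theta; move: (ex_intro _ _ _); rewrite E => P.
by congr RProd; exact: Prop_irrelevance.
Qed.

Lemma measurable_fprod_trunc n :
  measurable_fun setT (fun s : rprod t => fprod_trunc n (rprod_val s)).
Proof.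
elim: n => [|n IHn]; first exact: measurable_rprod_coord.
by apply: measurable_fun_pair => //; exact: measurable_rprod_coord.
Qed.

End truncation.

(* The library's instance of this fact is masked by its instance for products
   of subprobabilities, hence never inferred. *)
Lemma sigma_finite_product d1 d2 (T1 : measurableType d1) (T2 : measurableType d2)
    (R : realType) (m1 : {sigma_finite_measure set T1 -> \bar R})
    (m2 : {sigma_finite_measure set T2 -> \bar R}) :
  sigma_finite setT (m1 \x m2)%E.
Proof.
have /sigma_finiteP[F [TF ndF Ffin]] := sigma_finiteT m1.
have /sigma_finiteP[G [TG ndG Gfin]] := sigma_finiteT m2.
(* Equal indices suffice because both exhaustions increase. *)
exists (fun n => F n `*` G n).
  apply/esym; rewrite -subTset => -[x y] _.
  have [n _ Fx] : (\bigcup_n F n) x by rewrite -TF.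
  have [k _ Gy] : (\bigcup_n G n) y by rewrite -TG.
  exists (maxn n k) => //; split=> /=.
  - by move: Fx; apply/subsetPset; exact: ndF (leq_maxl _ _).
  - by move: Gy; apply/subsetPset; exact: ndG (leq_maxr _ _).
move=> n; have [mF Fn] := Ffin n; have [mG Gn] := Gfin n.
split; first exact: measurableX.
by rewrite product_measure1E// lte_mul_pinfty// ge0_fin_numE.
Qed.

(** [fprod_measure] is typed as a plain measure while [SQ_tensor] wants sigma-finite factors; the
    structure is recovered on an equal measure. *)
Lemma fprod_measure_sigma_finite (R : realType) (d : nat -> measure_display)
    (S : forall j, measurableType (d j))
    (mu : forall j, {sigma_finite_measure set (S j) -> \bar R}) n :
  exists m : {sigma_finite_measure set (Defs.fprod S n) -> \bar R},
    (m : {measure set _ -> \bar R}) = fprod_measure mu n.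
Proof.
elim: n => [|n [m mE]]; first by exists (mu 0%N).
pose m' : {sigma_finite_measure set (Defs.fprod S n * S n.+1)%type -> \bar R} :=
  HB.pack (m \x mu n.+1)%E (Measure_isSigmaFinite.Build _ _ _ (m \x mu n.+1)%E
    (sigma_finite_product m (mu n.+1))).
by exists m'; rewrite /= -mE.
Qed.

Section restricted_square_integrable.
Context (R : realType) (tens : forall A B : hilbertType R, hilbert_tensor A B).
Context (H : nat -> hilbertType R) (w : forall j, H j).
Context (d : nat -> measure_display) (S : forall j, measurableType (d j)).
Context (t : forall j, S j).
Context (mu : forall j, {sigma_finite_measure set (S j) -> \bar R}).
Context (pi : forall j, S j -> bounded_op (H j)).
Hypothesis pi_t : forall j (x : H j), pi (t j) x = x.
Hypothesis pi_SQ : forall j, SQ (mu j) (@pi j).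
Context (L : restricted_tensor tens w).

Local Notation HN := (tensor_upto tens H).

Lemma eq_tensor_op_upto (T T' : forall j, bounded_op (H j)) n :
  (forall j, (j <= n)%N -> T j = T' j) ->
  tensor_op_upto tens T n = tensor_op_upto tens T' n.
Proof.
elim: n => [|n IHn] TT /=; first exact: TT.
by rewrite TT// IHn// => j jn; apply: TT; exact: leqW.
Qed.

(** [n] coordinates are integrated while the operator acts on level [m]; the factors beyond [n] are
    [pi (t j)], hence identities. *)
Let opf n m (p : Defs.fprod S n) : bounded_op (HN m) :=
  tensor_op_upto tens (fun j => pi (fprod_fill t p j)) m.

Lemma SQ_tensor_op_upto n : SQ (fprod_measure mu n) (@opf n n).
Proof.
elim: n => [|n IHn].
  have -> : @opf 0%N 0%N = (fun p : Defs.fprod S 0 => @pi 0%N p).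
    by apply/funext => p; rewrite /opf /= dfwithin.
  exact: pi_SQ.
have -> : @opf n.+1 n.+1 = fun p : Defs.fprod S n.+1 =>
    tensor_op (tens (HN n) (H n.+1)) (opf n p.1) (pi p.2).
  apply/funext => p; rewrite /opf /= dfwithin; congr tensor_op.
  by apply: eq_tensor_op_upto => j jn; rewrite dfwithout// gtn_eqF.
have [m mE] := fprod_measure_sigma_finite mu n.
rewrite /= -mE; apply: SQ_tensor => //.
by rewrite mE.
Qed.

(** In the form [k + n] the level computes to a successor when [k] does, so each induction step adds
    one identity factor. *)
Lemma L2_contractive_tensor_op_upto n k : L2_contractive (fprod_measure mu n) (@opf n (k + n)).
Proof.
elim: k => [|k IHk].
  have [mS iS] := SQ_tensor_op_upto n.
  apply: (@SQ_L2_contractive _ _ _ _ _ _ setT).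
  - by rewrite closureT.
  - by move=> u v _ _; exact: mS.
  - by move=> u1 v1 u2 v2 _ _ _ _; exact: iS.
apply: (@L2_contractive_tensor _ _ _ _ _ (tens (HN (k + n)) (H (k + n).+1)) _
  (@opf n (k + n))) => // p x.
by rewrite fprod_fill_out ?pi_t// ltnS leq_addl.
Qed.

Let dense : set L := \bigcup_n range (hl_map L n).

Let dense_closure : closure dense = setT.
Proof. exact: hl_dense. Qed.

Lemma hl_inner n (x y : HN n) : inner (hl_map L n x) (hl_map L n y) = inner x y.
Proof. by apply: inner_isometry; exact: hl_isometry. Qed.

(** Stated eventually, so that several vectors can be placed on one common level. *)
Lemma dense_lift u : dense u -> \forall n \near \oo, exists x : HN n, u = hl_map L n x.
Proof.
move=> [m _ [x _ <-]]; exists m => // n /= mn.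
by have [z <-] := hl_map_embed L x mn; exists z.
Qed.

Let PI := restricted_tensor_op L t pi.

Lemma restricted_theta n m (p : Defs.fprod S n) (x : HN m) : (n <= m)%N ->
  PI (theta t p) (hl_map L m x) = hl_map L m (opf m p x).
Proof.
move=> nm; rewrite /PI restricted_tensor_opE// => j mj /=.
by rewrite fprod_fill_out// (leq_ltn_trans nm).
Qed.

Lemma restricted_L2_theta n :
  L2_contractive (fprod_measure mu n) (fun p => PI (theta t p)).
Proof.
apply: (L2_contractive_dense dense_closure) => u v Du Dv.
have [m [[[x ->] [y ->]] nm]] : exists m, ((exists x : HN m, u = hl_map L m x) /\
    (exists y : HN m, v = hl_map L m y)) /\ (n <= m)%N.
  have [m [? ?]] := filter_ex
    (filterI (filterI (dense_lift Du) (dense_lift Dv)) (nbhs_infty_ge n)).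
  by exists m.
have -> : (fun p => inner (PI (theta t p) (hl_map L m x)) (hl_map L m y)) =
    fun p : Defs.fprod S n => inner (opf m p x) y.
  by apply/funext => p; rewrite restricted_theta// hl_inner.
rewrite !hl_isometry; have h := @L2_contractive_tensor_op_upto n (m - n).
by rewrite subnK// in h; exact: h.
Qed.

(** Cutting [s] after coordinate [n] and refilling with [t] factors measurably through a finite
    product, where coefficients are already measurable for all [u] and [v]. It returns [s] itself
    once [n] is large, so the coefficient of [PI] is a pointwise limit of eventually constant
    sequences. *)
Lemma restricted_weakly_measurable : weakly_measurable PI.
Proof.
move=> u v; apply: (@cmeasurable_cvg _ _ _
  (fun n s => inner (PI (theta t (fprod_trunc n (rprod_val s))) u) v)).
  move=> n; have [mf _ _] := restricted_L2_theta n u v.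
  exact: (cmeasurable_comp (@measurable_fprod_trunc _ _ t n) mf).
move=> s; have [J sJ] := rprodP s.
have h : \forall n \near \oo,
    inner (PI (theta t (fprod_trunc n (rprod_val s))) u) v = inner (PI s u) v.
  exists J => // n /= Jn; rewrite theta_trunc// => j nj.
  by apply: sJ; exact: leq_trans (ltnW nj).
exact: cvg_near_cst h.
Qed.

Lemma restricted_L2_mu_upto n : L2_contractive (mu_upto mu t n) PI.
Proof.
move=> u v; have [_ a0 ab] := restricted_L2_theta n u v.
have mf := restricted_weakly_measurable u v; split=> //.
apply: le_trans ab.
rewrite ge0_integral_pushforward//.
- exact: measurable_theta.
- by apply/measurable_EFinP; apply: measurable_funX; exact: cmeasurable_rn.
- by move=> s _; rewrite lee_fin sqr_ge0.
Qed.

Lemma restricted_cintegral_mu_upto n u1 v1 u2 v2 :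
  cintegral (mu_upto mu t n) (SQ_integrand PI u1 v1 u2 v2) =
  cintegral (fprod_measure mu n)
    (SQ_integrand (fun p => PI (theta t p)) u1 v1 u2 v2).
Proof.
have [ir ii] := L2_contractive_integrable u1 v1 u2 v2 (restricted_L2_theta n).
have [mr mi] : cmeasurable (SQ_integrand PI u1 v1 u2 v2).
  rewrite SQ_integrandE; apply: cmeasurableM; first exact: restricted_weakly_measurable.
  by apply: cmeasurable_conj; exact: restricted_weakly_measurable.
rewrite /cintegral /Rintegral; congr Complex; congr fine.
- rewrite integral_pushforward//.
  + exact: measurable_theta.
  + exact/measurable_EFinP.
- rewrite integral_pushforward//.
  + exact: measurable_theta.
  + exact/measurable_EFinP.
Qed.

(** Once all four vectors lie on level [n], no identity factor is left and [SQ_tensor_op_upto] gives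
    the exact value. *)
Lemma restricted_cintegral_dense u1 v1 u2 v2 : dense u1 -> dense v1 -> dense u2 -> dense v2 ->
  \forall n \near \oo, cintegral (mu_upto mu t n) (SQ_integrand PI u1 v1 u2 v2) =
    inner u1 u2 * inner v2 v1.
Proof.
move=> Du1 Dv1 Du2 Dv2.
near=> n; rewrite restricted_cintegral_mu_upto.
have [x1 ->] : exists x : HN n, u1 = hl_map L n x by near: n; exact: dense_lift.
have [y1 ->] : exists x : HN n, v1 = hl_map L n x by near: n; exact: dense_lift.
have [x2 ->] : exists x : HN n, u2 = hl_map L n x by near: n; exact: dense_lift.
have [y2 ->] : exists x : HN n, v2 = hl_map L n x by near: n; exact: dense_lift.
rewrite !hl_inner; have [_ /(_ x1 y1 x2 y2)[_ <-]] := SQ_tensor_op_upto n.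
congr cintegral; apply/funext => p.
by rewrite /SQ_integrand !restricted_theta// !hl_inner.
Unshelve. all: by end_near. Qed.

End restricted_square_integrable.

Theorem theorem6p6 (R : realType)
    (tens : forall A B : hilbertType R, hilbert_tensor A B)
    (H : nat -> hilbertType R) (w : forall j, H j)
    (w_unit : forall j, `|w j| = 1)
    (d : nat -> measure_display) (S : forall j, measurableType (d j))
    (t : forall j, S j)
    (mu : forall j, {sigma_finite_measure set (S j) -> \bar R})
    (pi : forall j, S j -> bounded_op (H j))
    (pi_t : forall j (x : H j), pi j (t j) x = x)
    (pi_SQ : forall j, SQ (mu j) (pi j))
    (L : restricted_tensor tens w) :
  weakly_measurable (restricted_tensor_op L t pi) /\
  square_integrable_seq (fun n => mu_upto mu t n)
    (restricted_tensor_op L t pi).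
Proof.
split; first exact: (restricted_weakly_measurable pi_t pi_SQ).
apply: (square_integrable_seq_dense (hl_dense L)).
- by move=> n; exact: (restricted_L2_mu_upto pi_t pi_SQ).
- exact: (restricted_cintegral_dense pi_t pi_SQ).
Qed.
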